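(* Let $H$ be a Hopf $^*$-algebra over $\mathsf{C}$ and let $\mathcal{A},\mathcal{B}$ be idempotent non-degenerate $^*$-algebras over $\mathsf{C}$ with $^*$-actions of $H$ such that $\mathcal{A}\rtimes H$ and $\mathcal{B}\rtimes H$ are non-degenerate. If $\mathcal{A}$ and $\mathcal{B}$ are $H$-covariantly strongly Morita equivalent (resp. $H$-covariantly $^*$-Morita equivalent), then the crossed products $\mathcal{A}\rtimes H$ and $\mathcal{B}\rtimes H$ are strongly Morita equivalent (resp. $^*$-Morita equivalent).
   Context: **Ground ring.** $\mathsf{R}$ is an ordered ring (commutative, unital), $\mathsf{C}=\mathsf{R}(i)$ with $i^2=-1$, with complex conjugation. A $^*$-algebra over $\mathsf{C}$ is an associative $\mathsf{C}$-algebra with a $\mathsf{C}$-antilinear involutive antiautomorphism. It is *idempotent* if products $ab$ span it, *non-degenerate* if $a\mathcal{A}=0$ or $\mathcal{A}a=0$ implies $a=0$. For unital algebras, modules are unital. All modules carry a compatible $\mathsf{C}$-module structure; $\otimes=\otimes_{\mathsf{C}}$. **Hopf $^*$-algebra.** $H$ is a Hopf algebra over $\mathsf{C}$ ($\Delta(g)=g_{(1)}\otimes g_{(2)}$, counit $\epsilon$, antipode $S$) which is also a $^*$-algebra such that $\Delta,\epsilon$ are $^*$-homomorphisms and $S(S(g)^* )^*=g$. A $^*$-action of $H$ on $\mathcal{A}$ is a left $H$-module structure (with $1_H\triangleright a=a$) with $g\triangleright(ab)=(g_{(1)}\triangleright a)(g_{(2)}\triangleright b)$, $(g\triangleright a)^*=S(g)^*\triangleright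 a^*$, and $g\triangleright1=\epsilon(g)1$ if $\mathcal{A}$ is unital. The crossed product $\mathcal{A}\rtimes H$ is the $^*$-algebra $\mathcal{A}\otimes H$ with $(a\otimes g)(b\otimes h)=a(g_{(1)}\triangleright b)\otimes g_{(2)}h$, $(a\otimes g)^*=g_{(1)}^*\triangleright a^*\otimes g_{(2)}^*$. **Inner products.** $\omega:\mathcal{A}\to\mathsf{C}$ linear is positive if $\omega(a^*a)\ge0$; $a$ is positive if $\omega(a)\ge0$ for all positive $\omega$. An $\mathcal{A}$-valued inner product on a right $\mathcal{A}$-module is $\mathsf{C}$-sesquilinear (linear in the second argument) with $\langle x,y\cdot a\rangle=\langle x,y\rangle a$, $\langle x,y\rangle=\langle y,x\rangle^*$ (on left modules: left linear in the first argument). Non-degenerate: $\langle x,\cdot\rangle=0$ implies $x=0$. Full: its values span the algebra. Completely positive: $(\langle x_i,x_j\rangle)$ is positive in $M_n$ of the algebra for all $n$, $x_1,\dots,x_n$. **Morita equivalence.** A $^*$-equivalence bimodule is a $(\mathcal{B},\mathcal{A})$-bimodule $\mathcal{E}$ with $\mathcal{B}\cdot\mathcal{E}=\mathcal{E}=\mathcal{E}\cdot\mathcal{A}$ (spans) and full non-degenerate inner products ${}_{\mathcal{B}}\langle\cdot,\cdot\rangle$ (left $\mathcal{B}$-linear) and $\langle\cdot,\cdot\rangle_{\mathcal{A}}$ (right $\mathcal{A}$-linear) with $\langle b\cdot x,y\rangle_{\mathcal{A}}=\langle x,b^*\cdot y\rangle_{\mathcal{A}}$, ${}_{\mathcal{B}}\langle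 x\cdot a,y\rangle={}_{\mathcal{B}}\langle x,y\cdot a^*\rangle$, ${}_{\mathcal{B}}\langle x,y\rangle\cdot z=x\cdot\langle y,z\rangle_{\mathcal{A}}$. It is *strong* if both inner products are completely positive, and *$H$-covariant* if it carries an $H$-module structure with $g\triangleright\langle x,y\rangle_{\mathcal{A}}=\langle S(g_{(1)})^*\triangleright x,g_{(2)}\triangleright y\rangle_{\mathcal{A}}$, $g\triangleright{}_{\mathcal{B}}\langle x,y\rangle={}_{\mathcal{B}}\langle g_{(1)}\triangleright x,S(g_{(2)})^*\triangleright y\rangle$. Two $^*$-algebras are ($H$-covariantly) $^*$- resp. strongly Morita equivalent if there exists a corresponding ($H$-covariant) $^*$- resp. strong equivalence bimodule. *)

(* Defs.v *)
From HB Require Import structures.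
From mathcomp Require Import all_boot all_order all_algebra.
From mathcomp Require Import generic_quotient boolp complex.

Set Implicit Arguments.
Unset Strict Implicit.
Unset Printing Implicit Defensive.

Import Order.TTheory GRing.Theory Num.Theory.
Local Open Scope ring_scope.
Local Open Scope complex_scope.

(* The positive elements of an ordered ring R are closed under products and R is
   the disjoint union of -P, {0} and P, so R is a [realDomainType].  The library
   puts a ring structure on [R[i]] only when R is a field; [cpx] is the same type
   with the same operations over any ordered ring. *)
Definition cpx (R : realDomainType) : Type := R[i].

Section Cpx.
Variable R : realDomainType.

HB.instance Definition _ := GRing.Zmodule.copy (cpx R) R[i].

Let cpx_mul1 : left_id (1%:C : R[i]) (@ComplexField.mulc R).
Proof. by move=> [a b] /=; rewrite !mul1r !mul0r subr0 addr0. Qed.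

Let cpx_mulDl : left_distributive (@ComplexField.mulc R) (@ComplexField.addc R).
Proof.
move=> [a b] [c d] [e f] /=; rewrite !mulrDl !opprD -!addrA.
by congr ((_ + _) +i* (_ + _)); rewrite addrCA.
Qed.

Let cpx_1neq0 : (1%:C : R[i]) != 0%:C.
Proof. by rewrite eq_complex /= oner_eq0. Qed.

HB.instance Definition _ := GRing.Zmodule_isComNzRing.Build (cpx R)
  (@ComplexField.mulcA R) (@ComplexField.mulcC R) cpx_mul1 cpx_mulDl cpx_1neq0.

Definition cconj : cpx R -> cpx R := @conjc R.

Let cconj_zmod : zmod_morphism cconj.
Proof. by move=> [a b] [c d]; congr (_ +i* _); rewrite opprD. Qed.

Let cconj_monoid : monoid_morphism cconj.
Proof.
split=> [|[a b] [c d]]; first by congr (_ +i* _); rewrite oppr0.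
by congr (_ +i* _) => /=; rewrite ?mulrNN // opprD mulrN mulNr.
Qed.

HB.instance Definition _ := GRing.isZmodMorphism.Build _ _ cconj cconj_zmod.
HB.instance Definition _ := GRing.isMonoidMorphism.Build _ _ cconj cconj_monoid.

Lemma cconjK : involutive cconj.
Proof. by move=> [a b]; congr (_ +i* _); rewrite opprK. Qed.

Definition cge0 (z : cpx R) : Prop := complex.Im z = 0 /\ 0 <= complex.Re z.

End Cpx.

Definition bilin (K : pzRingType) (U V W : lmodType K) (f : U -> V -> W) : Prop :=
  (forall v, linear (f^~ v)) /\ (forall u, linear (f u)).

Definition spanning (K : pzRingType) (V : lmodType K) (P : V -> Prop) : Prop :=
  forall v : V, exists s : seq (K * V),
    (forall p, p \in s -> P p.2) /\ v = \sum_(p <- s) p.1 *: p.2.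

Section Tensor.
Variables (K : comNzRingType) (U V : lmodType K).

(* A list of pairs stands for the formal sum of its elements. *)
Inductive tens_eqv : seq (U * V) -> seq (U * V) -> Prop :=
| TensRefl s : tens_eqv s s
| TensSym s t : tens_eqv s t -> tens_eqv t s
| TensTrans s t r : tens_eqv s t -> tens_eqv t r -> tens_eqv s r
| TensPerm s t : perm_eq s t -> tens_eqv s t
| TensCat s s' t t' : tens_eqv s s' -> tens_eqv t t' ->
    tens_eqv (s ++ t) (s' ++ t')
| TensZero v : tens_eqv [:: (0, v)] [::]
| TensDl u u' v : tens_eqv [:: (u + u', v)] [:: (u, v); (u', v)]
| TensDr u v v' : tens_eqv [:: (u, v + v')] [:: (u, v); (u, v')]
| TensZ c u v : tens_eqv [:: (c *: u, v)] [:: (u, c *: v)].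

Definition tens_rel (s t : seq (U * V)) : bool := `[< tens_eqv s t >].

Let tens_rel_refl : reflexive tens_rel.
Proof. by move=> s; apply/asboolP; apply: TensRefl. Qed.

Let tens_rel_sym : symmetric tens_rel.
Proof. by move=> s t; apply: asbool_equiv_eq; split; apply: TensSym. Qed.

Let tens_rel_trans : transitive tens_rel.
Proof.
move=> t s r /asboolP st /asboolP tr; apply/asboolP; exact: TensTrans st tr.
Qed.

Canonical tens_equiv := EquivRel tens_rel tens_rel_refl tens_rel_sym tens_rel_trans.

Definition tens : Type := {eq_quot tens_equiv}%qT.

HB.instance Definition _ := Choice.on tens.

Local Open Scope quotient_scope.

Definition tclass (s : seq (U * V)) : tens := \pi_({eq_quot tens_equiv}) s.
Definition trepr (t : tens) : seq (U * V) := repr (t : {eq_quot tens_equiv}).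

Lemma treprK t : tclass (trepr t) = t. Proof. exact: reprK. Qed.

Lemma tclassP s t : tclass s = tclass t <-> tens_eqv s t.
Proof.
split; first by move/(@eqmodP _ tens_equiv) => /asboolP.
by move=> e; apply/(@eqmodP _ tens_equiv)/asboolP.
Qed.

Lemma trepr_class s : tens_eqv (trepr (tclass s)) s.
Proof. by apply/tclassP; rewrite treprK. Qed.

Definition pure (u : U) (v : V) : tens := tclass [:: (u, v)].

Definition tadd (s t : tens) : tens := tclass (trepr s ++ trepr t).
Definition tscale (c : K) (s : tens) : tens :=
  tclass [seq (c *: p.1, p.2) | p <- trepr s].
Definition topp (s : tens) : tens := tscale (-1) s.

Let class_add s t : tadd (tclass s) (tclass t) = tclass (s ++ t).
Proof. by apply/tclassP/TensCat; apply: trepr_class. Qed.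

Let scale_eqv c s t : tens_eqv s t ->
  tens_eqv [seq (c *: p.1, p.2) | p <- s] [seq (c *: p.1, p.2) | p <- t].
Proof.
elim=> {s t} [s|s t _|s t r _ st _ tr|s t st|s s' t t' _ h _ h'|v|u u' v|u v v'|d u v] /=.
- exact: TensRefl.
- exact: TensSym.
- exact: TensTrans st tr.
- exact/TensPerm/perm_map.
- by rewrite !map_cat; apply: TensCat.
- by rewrite scaler0; apply: TensZero.
- by rewrite scalerDr; apply: TensDl.
- exact: TensDr.
- by rewrite scalerA mulrC -scalerA; apply: TensZ.
Qed.

Let class_scale c s :
  tscale c (tclass s) = tclass [seq (c *: p.1, p.2) | p <- s].
Proof. by apply/tclassP/scale_eqv/trepr_class. Qed.

Let tens_ind_class (P : tens -> Prop) : (forall s, P (tclass s)) -> forall t, P t.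
Proof. by move=> h t; rewrite -[t]treprK. Qed.

Let taddA : associative tadd.
Proof.
by do 3![elim/tens_ind_class => ?]; rewrite !class_add catA.
Qed.

Let taddC : commutative tadd.
Proof.
elim/tens_ind_class => s; elim/tens_ind_class => t; rewrite !class_add.
by apply/tclassP/TensPerm; rewrite perm_catC.
Qed.

Let tadd0 : left_id (tclass [::]) tadd.
Proof. by elim/tens_ind_class => s; rewrite class_add. Qed.

Let taddN : left_inverse (tclass [::]) topp tadd.
Proof.
elim/tens_ind_class => s; rewrite /topp class_scale class_add; apply/tclassP.
elim: s => [|[u v] s IH] /=; first exact: TensRefl.
apply: (@TensTrans _ ([:: (-1 *: u, v); (u, v)] ++
   ([seq (-1 *: p.1, p.2) | p <- s] ++ s))).
  by apply: TensPerm; rewrite /= perm_cons perm_catC /= perm_cons perm_catC.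
apply: (TensCat (s' := [::]) _ IH); apply: TensTrans (TensSym (TensDl _ _ _)) _.
by rewrite scaleN1r addNr; apply: TensZero.
Qed.

HB.instance Definition _ := GRing.isZmodule.Build tens taddA taddC tadd0 taddN.

Let class_addE s t : tclass s + tclass t = tclass (s ++ t).
Proof. exact: class_add. Qed.

Let tscaleA c d (t : tens) : tscale c (tscale d t) = tscale (c * d) t.
Proof.
elim/tens_ind_class: t => s; rewrite !class_scale -map_comp.
by congr tclass; apply: eq_map => p /=; rewrite scalerA.
Qed.

Let tscale1 : left_id 1 tscale.
Proof.
elim/tens_ind_class => s; rewrite class_scale -[RHS]/(tclass s).
by congr tclass; rewrite -[RHS]map_id; apply: eq_map => -[u v] /=; rewrite scale1r.
Qed.

Let tscaleDr : right_distributive tscale +%R.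
Proof.
move=> c; elim/tens_ind_class => s; elim/tens_ind_class => t.
by rewrite class_addE !class_scale map_cat class_addE.
Qed.

Let tscaleDl (t : tens) : {morph tscale^~ t : c d / c + d}.
Proof.
move=> c d; elim/tens_ind_class: t => s; rewrite !class_scale class_addE.
apply/tclassP; elim: s => [|[u v] s IH] /=; first exact: TensRefl.
apply: (@TensTrans _ ([:: (c *: u, v); (d *: u, v)] ++
   ([seq (c *: p.1, p.2) | p <- s] ++ [seq (d *: p.1, p.2) | p <- s]))).
  by apply: (TensCat (s := [:: _])) => //; rewrite scalerDl; apply: TensDl.
apply: TensPerm; rewrite /= perm_cons.
by rewrite perm_sym perm_catC /= perm_cons perm_catC.
Qed.

HB.instance Definition _ :=
  GRing.Zmodule_isLmodule.Build K tens tscaleA tscale1 tscaleDr tscaleDl.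

End Tensor.

Notation "u ⊗ v" := (pure u v) (at level 40, left associativity) : ring_scope.

(* [tlift f t] is the sum of the [f u v] over a representative sum of the
   [u ⊗ v] for [t].  It only has a meaning when [f] is [balanced] (bilinear,
   or antilinear in both arguments), and is then the additive map induced by
   [f] on the tensor product: see [tlift_pure] and [tliftD]. *)
Definition tlift (K : comNzRingType) (U V : lmodType K) (W : nmodType)
    (f : U -> V -> W) (t : tens U V) : W :=
  \sum_(p <- trepr t) f p.1 p.2.

Section TensorTheory.
Variables (K : comNzRingType) (U V : lmodType K).
Implicit Types (t : tens U V) (W : zmodType).

Definition balanced W (f : U -> V -> W) : Prop :=
  [/\ forall v, {morph f^~ v : x y / x + y},
      forall u, {morph f u : x y / x + y}
    & forall c u v, f (c *: u) v = f u (c *: v)].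

Lemma tens_addE (s t : seq (U * V)) : tclass s + tclass t = tclass (s ++ t).
Proof. by apply/tclassP/TensCat; apply: trepr_class. Qed.

Lemma pureDl (v : V) : {morph (fun u : U => u ⊗ v) : x y / x + y}.
Proof. by move=> x y; rewrite tens_addE; apply/tclassP/TensDl. Qed.

Lemma pureDr (u : U) : {morph (fun v : V => u ⊗ v) : x y / x + y}.
Proof. by move=> x y; rewrite tens_addE; apply/tclassP/TensDr. Qed.

Lemma pureZlr c (u : U) (v : V) : (c *: u) ⊗ v = u ⊗ (c *: v).
Proof. by apply/tclassP/TensZ. Qed.

Lemma tclass_sum (s : seq (U * V)) : tclass s = \sum_(p <- s) p.1 ⊗ p.2.
Proof.
elim: s => [|[u v] s IH]; first by rewrite big_nil.
by rewrite big_cons -IH tens_addE.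
Qed.

Lemma tens_ind (P : tens U V -> Prop) :
  P 0 -> (forall u v, P (u ⊗ v)) -> (forall s t, P s -> P t -> P (s + t)) ->
  forall t, P t.
Proof.
move=> P0 P1 PD t; rewrite -[t]treprK tclass_sum.
by elim/big_rec: _ => // p s _; apply: PD.
Qed.

Lemma balanced0l W (f : U -> V -> W) : balanced f -> forall v, f 0 v = 0.
Proof. by case=> fl _ _ v; apply: (addrI (f 0 v)); rewrite -fl !addr0. Qed.

Lemma balanced_eqv W (f : U -> V -> W) : balanced f ->
  forall s t : seq (U * V), tens_eqv s t ->
  \sum_(p <- s) f p.1 p.2 = \sum_(p <- t) f p.1 p.2.
Proof.
move=> bf s0 t0; elim=> {s0 t0} [//|s t _ ->//|s t r _ -> _ ->//|s t|s s' t t' _ ih1 _ ih2||||] *.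
- exact: perm_big.
- by rewrite !big_cat /= ih1 ih2.
- by rewrite big_seq1 big_nil (balanced0l bf).
- by case: bf => fl _ _; rewrite !big_cons !big_nil !addr0 /= fl.
- by case: bf => _ fr _; rewrite !big_cons !big_nil !addr0 /= fr.
- by case: bf => _ _ fz; rewrite !big_seq1 /= fz.
Qed.

Lemma tlift_class W (f : U -> V -> W) : balanced f -> forall s,
  tlift f (tclass s) = \sum_(p <- s) f p.1 p.2.
Proof. by move=> bf s; apply/(balanced_eqv bf)/trepr_class. Qed.

Lemma tlift_pure W (f : U -> V -> W) : balanced f -> forall u v,
  tlift f (u ⊗ v) = f u v.
Proof. by move=> bf u v; rewrite (tlift_class bf) big_seq1. Qed.

Lemma tliftD W (f : U -> V -> W) : balanced f -> {morph tlift f : s t / s + t}.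
Proof.
move=> bf s t; rewrite -[s]treprK -[t]treprK tens_addE !(tlift_class bf).
by rewrite big_cat.
Qed.

Lemma tlift0 W (f : U -> V -> W) : balanced f -> tlift f 0 = 0.
Proof. by move=> bf; rewrite (tlift_class bf [::]) big_nil. Qed.

Lemma tens_scaleE c (s : seq (U * V)) :
  c *: tclass s = \sum_(p <- s) (c *: p.1) ⊗ p.2.
Proof.
rewrite tclass_sum scaler_sumr; apply: eq_bigr => p _.
rewrite -[LHS]/(tscale c (p.1 ⊗ p.2)) /tscale.
suff: forall r, tens_eqv r [:: p] ->
    tclass [seq (c *: q.1, q.2) | q <- r] = (c *: p.1) ⊗ p.2.
  by case: p => ? ? /(_ _ (trepr_class _)).
move=> r e; rewrite tclass_sum big_map.
have /balanced_eqv/(_ _ _ e) -> : balanced (fun u v => (c *: u) ⊗ v).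
  split=> [v x y|u x y|d u v]; rewrite ?scalerDr ?pureDl ?pureDr //.
  by rewrite scalerA mulrC -scalerA pureZlr.
by rewrite big_seq1.
Qed.

Lemma pureZl c (u : U) (v : V) : (c *: u) ⊗ v = c *: (u ⊗ v).
Proof. by rewrite tens_scaleE big_seq1. Qed.

Lemma pureZr c (u : U) (v : V) : u ⊗ (c *: v) = c *: (u ⊗ v).
Proof. by rewrite -pureZlr pureZl. Qed.

Lemma tliftZ W (f : U -> V -> W) : balanced f -> forall c t,
  tlift f (c *: t) = tlift (fun u v => f (c *: u) v) t.
Proof.
move=> bf c t; rewrite -{1}[t]treprK tens_scaleE (big_morph _ (tliftD bf) (tlift0 bf)).
by apply: eq_bigr => p _; rewrite tlift_pure.
Qed.

Lemma tlift_id t : tlift (@pure K U V) t = t.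
Proof. by rewrite -[RHS]treprK tclass_sum. Qed.

Lemma eq_tlift W (f g : U -> V -> W) t : (forall u v, f u v = g u v) ->
  tlift f t = tlift g t.
Proof. by move=> fg; apply: eq_bigr. Qed.

Lemma tlift_addf W (f g : U -> V -> W) t :
  tlift (fun u v => f u v + g u v) t = tlift f t + tlift g t.
Proof. exact: big_split. Qed.

Lemma tlift_morph (W W' : zmodType) (h : W -> W') :
  {morph h : x y / x + y} -> forall (f : U -> V -> W) t,
  h (tlift f t) = tlift (fun u v => h (f u v)) t.
Proof.
move=> hD f t; apply: (big_morph h hD).
by apply: (addrI (h 0)); rewrite -hD !addr0.
Qed.

Lemma tlift_exchange (U' V' : lmodType K) W (F : U -> V -> U' -> V' -> W)
    t (r : tens U' V') :
  tlift (fun u v => tlift (fun u' v' => F u v u' v') r) t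
  = tlift (fun u' v' => tlift (fun u v => F u v u' v') t) r.
Proof. exact: exchange_big. Qed.

Lemma pure_bilin : bilin (@pure K U V).
Proof.
by split=> [v c x y|u c x y]; rewrite ?pureDl ?pureDr ?pureZl ?pureZr.
Qed.

Lemma tlift_linear (W : lmodType K) (f : U -> V -> W) : bilin f -> linear (tlift f).
Proof.
case=> fl fr.
have bf : balanced f.
  split=> [v x y|u x y|c u v]; first by rewrite -{1}[x]scale1r fl scale1r.
    by rewrite -{1}[x]scale1r fr scale1r.
  have fl0 : f 0 v = 0.
    by apply: (addrI (f 0 v)); have:= fl v 1 0 0; rewrite !scale1r !addr0.
  have fr0 : f u 0 = 0.
    by apply: (addrI (f u 0)); have:= fr u 1 0 0; rewrite !scale1r !addr0.
  by rewrite -[c *: u]addr0 fl fl0 -[c *: v]addr0 fr fr0.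
move=> c s t; rewrite (tliftD bf) (tliftZ bf) scaler_sumr; congr (_ + _).
apply: eq_bigr => p _; rewrite -[c *: p.1]addr0 fl (balanced0l bf).
by rewrite addr0.
Qed.

End TensorTheory.

(* The multiplication is not assumed unital, hence no library ring structure. *)
HB.mixin Record isStarAlg (R : realDomainType) A of GRing.Lmodule (cpx R) A := {
  smul : A -> A -> A;
  sstar : A -> A;
  smul_bilin : bilin smul;
  smulA : associative smul;
  sstar_antilinear : forall c a b, sstar (c *: a + b) = cconj c *: sstar a + sstar b;
  sstarK : involutive sstar;
  sstarM : forall a b, sstar (smul a b) = smul (sstar b) (sstar a)
}.

#[short(type="starAlgType")]
HB.structure Definition StarAlg (R : realDomainType) :=
  { A of isStarAlg R A & GRing.Lmodule (cpx R) A }.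

Notation "a ** b" := (smul a b) (at level 40, left associativity) : ring_scope.

Section StarAlgPredicates.
Variables (R : realDomainType) (A : starAlgType R).

Definition idempotent_alg : Prop := spanning (fun c : A => exists a b, c = a ** b).

Definition nondegenerate_alg : Prop :=
  (forall a : A, (forall b, a ** b = 0) -> a = 0) /\
  (forall a : A, (forall b, b ** a = 0) -> a = 0).

Definition is_unit_elt (u : A) : Prop := forall a, u ** a = a /\ a ** u = a.

Definition positive_functional (w : {scalar A}) : Prop :=
  forall a, cge0 (w (sstar a ** a)).

Definition positive_elt (a : A) : Prop :=
  forall w : {scalar A}, positive_functional w -> cge0 (w a).

End StarAlgPredicates.

Section StarAlgTheory.
Variables (R : realDomainType) (A : starAlgType R).
Implicit Types a b : A.

Lemma smulDl b : {morph (fun a : A => a ** b) : x y / x + y}.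
Proof. by move=> x y; have:= (smul_bilin (s := A)).1 b 1 x y; rewrite !scale1r. Qed.

Lemma smulDr a : {morph (fun b : A => a ** b) : x y / x + y}.
Proof. by move=> x y; have:= (smul_bilin (s := A)).2 a 1 x y; rewrite !scale1r. Qed.

Lemma smul0l b : 0 ** b = 0.
Proof. by apply: (addrI (0 ** b)); rewrite -smulDl !addr0. Qed.

Lemma smul0r a : a ** 0 = 0.
Proof. by apply: (addrI (a ** 0)); rewrite -smulDr !addr0. Qed.

Lemma smulZl c a b : (c *: a) ** b = c *: (a ** b).
Proof. by have:= (smul_bilin (s := A)).1 b c a 0; rewrite !addr0 smul0l addr0. Qed.

Lemma smulZr c a b : a ** (c *: b) = c *: (a ** b).
Proof. by have:= (smul_bilin (s := A)).2 a c b 0; rewrite !addr0 smul0r addr0. Qed.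

Lemma sstarD : {morph (@sstar R A) : a b / a + b}.
Proof. by move=> a b; have:= sstar_antilinear 1 a b; rewrite rmorph1 !scale1r. Qed.

Lemma sstar0 : sstar 0 = 0 :> A.
Proof. by apply: (addrI (sstar 0)); rewrite -sstarD !addr0. Qed.

Lemma sstarZ c a : sstar (c *: a) = cconj c *: sstar a.
Proof. by have:= sstar_antilinear c a 0; rewrite sstar0 !addr0. Qed.

End StarAlgTheory.

Definition starmx (R : realDomainType) (A : starAlgType R) (n : nat) : Type := 'M[A]_n.

Section StarMx.
Variables (R : realDomainType) (A : starAlgType R) (n : nat).
Implicit Types M N : 'M[A]_n.

HB.instance Definition _ := GRing.Zmodule.copy (starmx A n) 'M[A]_n.

Definition starmx_scale (c : cpx R) M : 'M[A]_n := \matrix_(i, j) (c *: M i j).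
Definition starmx_mul M N : 'M[A]_n := \matrix_(i, j) \sum_k M i k ** N k j.
Definition starmx_star M : 'M[A]_n := \matrix_(i, j) sstar (M j i).

Let scaleA c d M : starmx_scale c (starmx_scale d M) = starmx_scale (c * d) M.
Proof. by apply/matrixP=> i j; rewrite !mxE scalerA. Qed.

Let scale1 : left_id 1 starmx_scale.
Proof. by move=> M; apply/matrixP=> i j; rewrite !mxE scale1r. Qed.

Let scaleDr : right_distributive starmx_scale +%R.
Proof. by move=> c M N; apply/matrixP=> i j; rewrite !mxE scalerDr. Qed.

Let scaleDl M : {morph starmx_scale^~ M : c d / c + d}.
Proof. by move=> c d; apply/matrixP=> i j; rewrite !mxE scalerDl. Qed.

HB.instance Definition _ := GRing.Zmodule_isLmodule.Build (cpx R) (starmx A n)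
  scaleA scale1 scaleDr scaleDl.

Let mul_bilin : bilin (starmx_mul : starmx A n -> starmx A n -> starmx A n).
Proof.
split=> [N c M M'|M c N N']; apply/matrixP=> i j; rewrite !mxE scaler_sumr -big_split.
  by apply: eq_bigr => k _; rewrite !mxE smulDl smulZl.
by apply: eq_bigr => k _; rewrite !mxE smulDr smulZr.
Qed.

Let mulA : associative starmx_mul.
Proof.
move=> M N P; apply/matrixP=> i j; rewrite !mxE.
transitivity (\sum_k \sum_l M i k ** (N k l ** P l j)).
  apply: eq_bigr => k _; rewrite !mxE.
  by apply: (big_morph (smul (M i k)) (smulDr _) (smul0r _)).
rewrite exchange_big; apply: eq_bigr => l _; rewrite !mxE.
rewrite (big_morph (fun a => a ** P l j) (smulDl _) (smul0l _)).
by apply: eq_bigr => k _; rewrite smulA.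
Qed.

Let star_antilinear (c : cpx R) (M N : starmx A n) :
  starmx_star (c *: M + N) = (cconj c *: (starmx_star M : starmx A n) + starmx_star N).
Proof. by apply/matrixP=> i j; rewrite !mxE sstarD sstarZ. Qed.

Let starK : involutive starmx_star.
Proof. by move=> M; apply/matrixP=> i j; rewrite !mxE sstarK. Qed.

Let starM M N : starmx_star (starmx_mul M N) = starmx_mul (starmx_star N) (starmx_star M).
Proof.
apply/matrixP=> i j; rewrite !mxE (big_morph _ (@sstarD _ _) (@sstar0 _ _)).
by apply: eq_bigr => k _; rewrite !mxE sstarM.
Qed.

HB.instance Definition _ := isStarAlg.Build R (starmx A n)
  mul_bilin mulA star_antilinear starK starM.

End StarMx.

Definition tens_mul (K : comNzRingType) (H : algType K) (s t : tens H H) : tens H H :=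
  tlift (fun a b => tlift (fun c d => (a * c) ⊗ (b * d)) t) s.
Definition tens_star (K : comNzRingType) (H : algType K) (star : H -> H) (t : tens H H)
    : tens H H :=
  tlift (fun a b => star a ⊗ star b) t.

(* [tlift f (comul g)] is Sweedler's [f g_(1) g_(2)]. *)
HB.mixin Record isHopfStar (R : realDomainType) H of GRing.Algebra (cpx R) H := {
  comul : H -> tens H H;
  counit : H -> cpx R;
  antipode : H -> H;
  hstar : H -> H;
  comul_linear : linear comul;
  comulA : forall g,
    tlift (fun x y => tlift (fun u v => (u ⊗ v) ⊗ y) (comul x)) (comul g) =
    tlift (fun x y => tlift (fun u v => (x ⊗ u) ⊗ v) (comul y)) (comul g)
      :> tens (tens H H) H;
  comulM : forall g h, comul (g * h) = tens_mul (comul g) (comul h);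
  comul1 : comul 1 = 1 ⊗ 1;
  counit_scalar : scalar counit;
  counitM : monoid_morphism counit;
  counitl : forall g, tlift (fun x y => counit x *: y) (comul g) = g;
  counitr : forall g, tlift (fun x y => counit y *: x) (comul g) = g;
  antipode_linear : linear antipode;
  antipodel : forall g, tlift (fun x y => antipode x * y) (comul g) = counit g *: 1;
  antipoder : forall g, tlift (fun x y => x * antipode y) (comul g) = counit g *: 1;
  hstar_antilinear : forall c g h, hstar (c *: g + h) = cconj c *: hstar g + hstar h;
  hstarK : involutive hstar;
  hstarM : forall g h, hstar (g * h) = hstar h * hstar g;
  comul_star : forall g, comul (hstar g) = tens_star hstar (comul g);
  counit_star : forall g, counit (hstar g) = cconj (counit g);
  antipode_star : forall g, hstar (antipode (hstar (antipode g))) = g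
}.

#[short(type="hopfStarType")]
HB.structure Definition HopfStar (R : realDomainType) :=
  { H of isHopfStar R H & GRing.Algebra (cpx R) H }.

Definition hopf_module (R : realDomainType) (H : hopfStarType R) (E : lmodType (cpx R))
    (act : H -> E -> E) : Prop :=
  [/\ bilin act, forall x, act 1 x = x & forall g h x, act (g * h) x = act g (act h x)].

Record star_action (R : realDomainType) (H : hopfStarType R) (A : starAlgType R) := {
  sact :> H -> A -> A;
  sact_module : hopf_module sact;
  sactM : forall g a b,
    sact g (a ** b) = tlift (fun g1 g2 => sact g1 a ** sact g2 b) (comul g);
  sact_star : forall g a, sstar (sact g a) = sact (hstar (antipode g)) (sstar a);
  sact_unit : forall u, is_unit_elt u -> forall g, sact g u = counit g *: u
}.

Definition crossed (R : realDomainType) (H : hopfStarType R) (A : starAlgType R)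
  (act : star_action H A) : Type := tens A H.

Section HopfTheory.
Variables (R : realDomainType) (H : hopfStarType R).
Implicit Types g h : H.

HB.instance Definition _ := GRing.isLinear.Build (cpx R) H (tens H H) _
  (@comul R H) comul_linear.
HB.instance Definition _ := GRing.isLinear.Build (cpx R) H H _
  (@antipode R H) antipode_linear.

Lemma hstarD : {morph (@hstar R H) : g h / g + h}.
Proof. by move=> g h; have:= hstar_antilinear 1 g h; rewrite rmorph1 !scale1r. Qed.

Lemma hstar0 : hstar 0 = 0 :> H.
Proof. by apply: (addrI (hstar 0)); rewrite -hstarD !addr0. Qed.

Lemma hstarZ c g : hstar (c *: g) = cconj c *: hstar g.
Proof. by have:= hstar_antilinear c g 0; rewrite hstar0 !addr0. Qed.

Lemma hstar1 : hstar 1 = 1 :> H.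
Proof. by rewrite -[LHS]mulr1 -{2}[1]hstarK -hstarM mulr1 hstarK. Qed.

Definition tribalanced (W : zmodType) (F : H -> H -> H -> W) : Prop :=
  [/\ forall y z, {morph (fun x => F x y z) : x x' / x + x'},
      forall x z, {morph (fun y => F x y z) : y y' / y + y'},
      forall x y, {morph (fun z => F x y z) : z z' / z + z'},
      forall c x y z, F (c *: x) y z = F x (c *: y) z
    & forall c x y z, F x (c *: y) z = F x y (c *: z)].

Lemma sweedlerA (W : zmodType) (F : H -> H -> H -> W) : tribalanced F -> forall g,
  tlift (fun x z => tlift (fun u v => F u v z) (comul x)) (comul g) =
  tlift (fun x z => tlift (fun u v => F x u v) (comul z)) (comul g).
Proof.
case=> F1 F2 F3 F12 F23 g.
have bF z : balanced (fun u v => F u v z) by split.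
have bG : balanced (fun (t : tens H H) z => tlift (fun u v => F u v z) t).
  split=> [z s t|t z z'|c t z]; first exact: tliftD.
    by rewrite -tlift_addf; apply: eq_tlift => u v; apply: F3.
  by rewrite tliftZ //; apply: eq_tlift => u v; rewrite F12 F23.
have := congr1 (tlift (fun (t : tens H H) z => tlift (fun u v => F u v z) t)) (comulA g).
rewrite !(tlift_morph (tliftD bG)) => e.
etransitivity; last (etransitivity; first exact: e).
  apply: eq_tlift => x y; rewrite (tlift_morph (tliftD bG)).
  by apply: eq_tlift => u v; rewrite (tlift_pure bG) (tlift_pure (bF _)).
apply: eq_tlift => x y; rewrite (tlift_morph (tliftD bG)).
by apply: eq_tlift => u v; rewrite (tlift_pure bG) (tlift_pure (bF _)).
Qed.

Lemma sweedlerM (W : zmodType) (f : H -> H -> W) : balanced f -> forall g h,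
  tlift f (comul (g * h)) =
  tlift (fun x y => tlift (fun u v => f (x * u) (y * v)) (comul h)) (comul g).
Proof.
move=> bf g h; rewrite comulM /tens_mul (tlift_morph (tliftD bf)).
apply: eq_tlift => x y; rewrite (tlift_morph (tliftD bf)).
by apply: eq_tlift => u v; rewrite (tlift_pure bf).
Qed.

Lemma sweedler_star (W : zmodType) (f : H -> H -> W) : balanced f -> forall g,
  tlift f (comul (hstar g)) = tlift (fun x y => f (hstar x) (hstar y)) (comul g).
Proof.
move=> bf g; rewrite comul_star /tens_star (tlift_morph (tliftD bf)).
by apply: eq_tlift => x y; rewrite (tlift_pure bf).
Qed.

Lemma antipodel_star g :
  tlift (fun x y => hstar y * hstar (antipode x)) (comul g)
  = cconj (counit g) *: 1.
Proof.
rewrite -[in RHS]hstar1 -hstarZ -antipodel (tlift_morph hstarD).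
by apply: eq_tlift => x y; rewrite hstarM.
Qed.

Lemma antipode_starl g :
  tlift (fun x y => y * hstar (antipode (hstar x))) (comul g) = counit g *: 1.
Proof.
have b : balanced (fun x y : H => hstar y * hstar (antipode x)).
  split=> [v x y|u x y|c u v]; rewrite ?raddfD ?hstarD ?mulrDr ?mulrDl //.
  by rewrite linearZ /= !hstarZ -scalerAr -scalerAl.
have := antipodel_star (hstar g); rewrite (sweedler_star b) counit_star cconjK => <-.
by apply: eq_tlift => x y; rewrite hstarK.
Qed.

End HopfTheory.

Section Crossed.
Variables (R : realDomainType) (H : hopfStarType R) (A : starAlgType R).
Variable act : star_action H A.
Local Notation "g ▷ a" := (act g a) (at level 38, right associativity).
Implicit Types (a b : A) (g h : H) (c : cpx R) (s t : tens A H).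

Let actDl a : {morph (fun g => g ▷ a) : g h / g + h}.
Proof.
by case: (sact_module act) => -[al _] _ _ g h; have:= al a 1 g h; rewrite !scale1r.
Qed.

Let actDr g : {morph act g : a b / a + b}.
Proof.
by case: (sact_module act) => -[_ ar] _ _ a b; have:= ar g 1 a b; rewrite !scale1r.
Qed.

Let act0l a : 0 ▷ a = 0.
Proof. by apply: (addrI (0 ▷ a)); rewrite -actDl !addr0. Qed.

Let act0r g : g ▷ 0 = 0.
Proof. by apply: (addrI (g ▷ 0)); rewrite -actDr !addr0. Qed.

Let actZl c g a : (c *: g) ▷ a = c *: (g ▷ a).
Proof.
by case: (sact_module act) => -[al _] _ _; have:= al a c g 0; rewrite act0l !addr0.
Qed.

Let actZr c g a : g ▷ (c *: a) = c *: (g ▷ a).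
Proof.
by case: (sact_module act) => -[_ ar] _ _; have:= ar g c a 0; rewrite act0r !addr0.
Qed.

Let act1 a : 1 ▷ a = a.
Proof. by case: (sact_module act). Qed.

Let actA g h a : (g * h) ▷ a = g ▷ h ▷ a.
Proof. by case: (sact_module act). Qed.

Definition crossed_mul s t : tens A H :=
  tlift (fun a g => tlift (fun b h =>
    tlift (fun g1 g2 => (a ** (g1 ▷ b)) ⊗ (g2 * h)) (comul g)) t) s.

Definition crossed_star s : tens A H :=
  tlift (fun a g => tlift (fun g1 g2 =>
    (hstar g1 ▷ sstar a) ⊗ hstar g2) (comul g)) s.

Let bal_mul1 a b h : balanced (fun g1 g2 => (a ** (g1 ▷ b)) ⊗ (g2 * h)).
Proof.
split=> [v x y|u x y|c u v]; rewrite ?actDl ?smulDr ?pureDl ?mulrDl ?pureDr //.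
by rewrite actZl smulZr pureZl -scalerAl pureZr.
Qed.

Let bal_mul2 a g : balanced (fun b h =>
  tlift (fun g1 g2 => (a ** (g1 ▷ b)) ⊗ (g2 * h)) (comul g)).
Proof.
split=> [v x y|u x y|c u v]; rewrite -?tlift_addf; apply: eq_tlift => g1 g2.
- by rewrite actDr smulDr pureDl.
- by rewrite mulrDr pureDr.
- by rewrite actZr smulZr pureZl -scalerAr pureZr.
Qed.

Let bal_mul3 t : balanced (fun a g => tlift (fun b h =>
    tlift (fun g1 g2 => (a ** (g1 ▷ b)) ⊗ (g2 * h)) (comul g)) t).
Proof.
split=> [v x y|u x y|c u v]; rewrite -?tlift_addf; apply: eq_tlift => b h.
- by rewrite -tlift_addf; apply: eq_tlift => g1 g2; rewrite smulDl pureDl.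
- by rewrite raddfD /= (tliftD (bal_mul1 _ _ _)).
- rewrite linearZ /= (tliftZ (bal_mul1 _ _ _)); apply: eq_tlift => g1 g2.
  by rewrite actZl smulZl smulZr.
Qed.

Let mulDl t : {morph crossed_mul^~ t : s s' / s + s'}.
Proof. by move=> s s'; apply: (tliftD (bal_mul3 t)). Qed.

Let mulDr s : {morph crossed_mul s : t t' / t + t'}.
Proof.
move=> t t'; rewrite /crossed_mul -tlift_addf; apply: eq_tlift => a g.
by rewrite (tliftD (bal_mul2 _ _)).
Qed.

Let mulZl c s t : crossed_mul (c *: s) t = c *: crossed_mul s t.
Proof.
rewrite {1}/crossed_mul (tliftZ (bal_mul3 t)) (tlift_morph (scalerDr c)).
apply: eq_tlift => a g; rewrite (tlift_morph (scalerDr c)); apply: eq_tlift => b h.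
rewrite (tlift_morph (scalerDr c)); apply: eq_tlift => g1 g2.
by rewrite smulZl pureZl.
Qed.

Let mulZr c s t : crossed_mul s (c *: t) = c *: crossed_mul s t.
Proof.
rewrite /crossed_mul (tlift_morph (scalerDr c)); apply: eq_tlift => a g.
rewrite (tliftZ (bal_mul2 _ _)) (tlift_morph (scalerDr c)); apply: eq_tlift => b h.
rewrite (tlift_morph (scalerDr c)); apply: eq_tlift => g1 g2.
by rewrite actZr smulZr pureZl.
Qed.

Let mul_bilin : bilin crossed_mul.
Proof.
by split=> [t c s s'|s c t t']; rewrite ?mulDl ?mulDr ?mulZl ?mulZr.
Qed.

Lemma crossed_mul_pure a g b h : crossed_mul (a ⊗ g) (b ⊗ h) =
  tlift (fun g1 g2 => (a ** (g1 ▷ b)) ⊗ (g2 * h)) (comul g).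
Proof. by rewrite /crossed_mul (tlift_pure (bal_mul3 _)) (tlift_pure (bal_mul2 _ _)). Qed.

Let mul0l t : crossed_mul 0 t = 0.
Proof. exact: (tlift0 (bal_mul3 t)). Qed.

Let mul0r s : crossed_mul s 0 = 0.
Proof. by apply: (addrI (crossed_mul s 0)); rewrite -mulDr !addr0. Qed.

Let mulA : associative crossed_mul.
Proof.
move=> x y z; elim/tens_ind: x => [|a g|x x' IH IH']; last first.
- by rewrite !mulDl IH IH'.
- elim/tens_ind: y => [|b h|y y' IH IH']; last first.
  + by rewrite mulDl !mulDr mulDl IH IH'.
  + elim/tens_ind: z => [|d k|z z' IH IH']; last first.
    * by rewrite !mulDr IH IH'.
    * rewrite !crossed_mul_pure (tlift_morph (mulDr _)) (tlift_morph (mulDl _)).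
      pose F u v w : tens A H := tlift (fun h1 h2 =>
        (a ** ((u ▷ b) ** (v ▷ h1 ▷ d))) ⊗ (w * (h2 * k))) (comul h).
      have bF : tribalanced F.
        split=> [v w u u'|u w v v'|u v w w'|e u v w|e u v w];
          rewrite /F -?tlift_addf; apply: eq_tlift => h1 h2.
        - by rewrite actDl smulDl smulDr pureDl.
        - by rewrite actDl 2!smulDr pureDl.
        - by rewrite mulrDl pureDr.
        - by rewrite !actZl smulZl !smulZr.
        - by rewrite !actZl !smulZr pureZl -scalerAl pureZr.
      transitivity (tlift (fun g1 g2 => tlift (fun u v => F u v g2) (comul g1)) (comul g)).
        under eq_tlift => h1 h2 do rewrite crossed_mul_pure.
        rewrite tlift_exchange; apply: eq_tlift => g1 g2.
        rewrite tlift_exchange; apply: eq_tlift => h1 h2.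
        rewrite sactM (tlift_morph (smulDr a)) (tlift_morph (pureDl _)).
        by apply: eq_tlift => u v.
      rewrite (sweedlerA bF); apply: eq_tlift => g1 g2.
      rewrite crossed_mul_pure (sweedlerM (bal_mul1 _ _ _)).
      apply: eq_tlift => u v; apply: eq_tlift => h1 h2.
      by rewrite actA smulA mulrA.
    * by rewrite !mul0r.
  + by rewrite mul0l !mul0r mul0l.
- by rewrite !mul0l.
Qed.

Let bal_star1 a : balanced (fun g1 g2 => (hstar g1 ▷ sstar a) ⊗ hstar g2).
Proof.
split=> [v x y|u x y|c u v]; rewrite ?hstarD ?actDl ?pureDl ?pureDr //.
by rewrite !hstarZ actZl pureZl pureZr.
Qed.

Let bal_star2 : balanced (fun a g =>
  tlift (fun g1 g2 => (hstar g1 ▷ sstar a) ⊗ hstar g2) (comul g)).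
Proof.
split=> [v x y|u x y|c u v].
- by rewrite -tlift_addf; apply: eq_tlift => g1 g2; rewrite sstarD actDr pureDl.
- by rewrite raddfD /= (tliftD (bal_star1 _)).
- rewrite linearZ /= (tliftZ (bal_star1 _)); apply: eq_tlift => g1 g2.
  by rewrite hstarZ sstarZ actZl actZr.
Qed.

Let starD : {morph crossed_star : s t / s + t}.
Proof. exact: tliftD bal_star2. Qed.

Let star0 : crossed_star 0 = 0.
Proof. exact: tlift0 bal_star2. Qed.

Let star_antilinear c s t :
  crossed_star (c *: s + t) = cconj c *: crossed_star s + crossed_star t.
Proof.
rewrite starD; congr (_ + _); rewrite /crossed_star (tliftZ bal_star2).
rewrite (tlift_morph (scalerDr _)); apply: eq_tlift => a g.
rewrite (tlift_morph (scalerDr _)); apply: eq_tlift => g1 g2.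
by rewrite sstarZ actZr pureZl.
Qed.

Lemma crossed_star_pure a g : crossed_star (a ⊗ g) =
  tlift (fun g1 g2 => (hstar g1 ▷ sstar a) ⊗ hstar g2) (comul g).
Proof. exact: (tlift_pure bal_star2). Qed.

Let starK : involutive crossed_star.
Proof.
move=> x; elim/tens_ind: x => [|a g|x x' IH IH']; first by rewrite !star0.
  rewrite crossed_star_pure (tlift_morph starD).
  pose F u v w : tens A H := ((v * hstar (antipode (hstar u))) ▷ a) ⊗ w.
  have bF : tribalanced F.
    split=> [v w u u'|u w v v'|u v w w'|e u v w|e u v w]; rewrite /F.
    - by rewrite hstarD raddfD /= hstarD mulrDr actDl pureDl.
    - by rewrite mulrDl actDl pureDl.
    - exact: pureDr.
    - by rewrite hstarZ linearZ /= hstarZ cconjK -scalerAr -scalerAl.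
    - by rewrite -scalerAl actZl pureZl pureZr.
  transitivity (tlift (fun g1 g2 => tlift (fun u v => F g1 u v) (comul g2)) (comul g)).
    apply: eq_tlift => g1 g2.
    rewrite crossed_star_pure (sweedler_star (bal_star1 _)).
    by apply: eq_tlift => u v; rewrite !hstarK sact_star sstarK /F actA.
  rewrite -(sweedlerA bF) -[in RHS](counitl g) (tlift_morph (pureDr _)).
  apply: eq_tlift => g1 g2.
  rewrite -(tlift_morph (h := fun d => (d ▷ a) ⊗ g2)); last first.
    by move=> d d'; rewrite actDl pureDl.
  by rewrite antipode_starl actZl act1 pureZlr.
by rewrite !starD IH IH'.
Qed.

Let act_antipode a b g :
  tlift (fun x y => hstar y ▷ ((hstar (antipode x) ▷ b) ** a)) (comul g)
  = b ** (hstar g ▷ a).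
Proof.
pose F x y z : A := ((hstar y * hstar (antipode x)) ▷ b) ** (hstar z ▷ a).
have bM d d' : balanced (fun x y => (x ▷ d) ** (y ▷ d')).
  split=> [v x y|u x y|c u v]; rewrite ?actDl ?smulDl ?smulDr //.
  by rewrite !actZl smulZl smulZr.
have bF : tribalanced F.
  split=> [v w u u'|u w v v'|u v w w'|e u v w|e u v w]; rewrite /F.
  - by rewrite raddfD /= hstarD mulrDr actDl smulDl.
  - by rewrite hstarD mulrDl actDl smulDl.
  - by rewrite hstarD actDl smulDr.
  - by rewrite linearZ /= !hstarZ -scalerAr -scalerAl.
  - by rewrite !hstarZ -scalerAl !actZl smulZl smulZr.
transitivity (tlift (fun x y => tlift (fun u v => F x u v) (comul y)) (comul g)).
  apply: eq_tlift => x y; rewrite sactM (sweedler_star (bM _ _)).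
  by apply: eq_tlift => u v; rewrite /F actA.
rewrite -(sweedlerA bF) -[in RHS](counitl g) (tlift_morph (@hstarD _ _)).
rewrite (tlift_morph (actDl a)) (tlift_morph (smulDr b)).
apply: eq_tlift => x y.
rewrite -(tlift_morph (h := fun d => (d ▷ b) ** (hstar y ▷ a))); last first.
  by move=> d d'; rewrite actDl smulDl.
by rewrite antipodel_star actZl act1 hstarZ actZl smulZl smulZr.
Qed.

Let starM s t : crossed_star (crossed_mul s t) =
  crossed_mul (crossed_star t) (crossed_star s).
Proof.
elim/tens_ind: s => [|a g|s s' IH IH']; last first.
- by rewrite mulDl !starD mulDr IH IH'.
- elim/tens_ind: t => [|b h|t t' IH IH']; last first.
  + by rewrite mulDr !starD mulDl IH IH'.
  + rewrite crossed_mul_pure (tlift_morph starD) !crossed_star_pure.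
    rewrite (tlift_morph (mulDl _)).
    under [RHS]eq_tlift => h1 h2 do rewrite (tlift_morph (mulDr _)).
    pose G x y z : tens A H := tlift (fun h1 h2 =>
      (hstar h1 ▷ hstar y ▷ ((hstar (antipode x) ▷ sstar b) ** sstar a))
        ⊗ (hstar h2 * hstar z)) (comul h).
    have bG : tribalanced G.
      split=> [v w u u'|u w v v'|u v w w'|e u v w|e u v w];
        rewrite /G -?tlift_addf; apply: eq_tlift => h1 h2.
      - by rewrite raddfD /= hstarD actDl smulDl !actDr pureDl.
      - by rewrite hstarD actDl actDr pureDl.
      - by rewrite hstarD mulrDr pureDr.
      - by rewrite linearZ /= !hstarZ !actZl smulZl !actZr.
      - by rewrite !hstarZ !actZl !actZr pureZl -scalerAr pureZr.
    transitivity (tlift (fun g1 g2 => tlift (fun u v => G g1 u v) (comul g2)) (comul g)).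
      apply: eq_tlift => g1 g2.
      rewrite crossed_star_pure (sweedlerM (bal_star1 _)).
      apply: eq_tlift => u v; apply: eq_tlift => h1 h2.
      by rewrite !hstarM actA sstarM sact_star.
    rewrite -(sweedlerA bG) [RHS]tlift_exchange; apply: eq_tlift => g1 g2.
    rewrite tlift_exchange.
    pose F x y z : tens A H :=
      ((hstar x ▷ sstar b) ** (hstar y ▷ hstar g1 ▷ sstar a))
        ⊗ (hstar z * hstar g2).
    have bF : tribalanced F.
      split=> [v w u u'|u w v v'|u v w w'|e u v w|e u v w]; rewrite /F.
      - by rewrite hstarD actDl smulDl pureDl.
      - by rewrite hstarD actDl smulDr pureDl.
      - by rewrite hstarD mulrDl pureDr.
      - by rewrite !hstarZ !actZl smulZl smulZr.
      - by rewrite !hstarZ !actZl smulZr pureZl -scalerAl pureZr.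
    transitivity (tlift (fun h1 h2 => tlift (fun u v => F h1 u v) (comul h2)) (comul h)).
      rewrite -(sweedlerA bF); apply: eq_tlift => h1 h2.
      rewrite -(tlift_morph (pureDl _)) -(tlift_morph (actDr _)) act_antipode.
      have bM d d' : balanced (fun x y => (x ▷ d) ** (y ▷ d')).
        split=> [v x y|u x y|c u v]; rewrite ?actDl ?smulDl ?smulDr //.
        by rewrite !actZl smulZl smulZr.
      by rewrite sactM (sweedler_star (bM _ _)) (tlift_morph (pureDl _)).
    apply: eq_tlift => h1 h2.
    rewrite crossed_mul_pure (sweedler_star (bal_mul1 _ _ _)).
    by apply: eq_tlift.
  + by rewrite mul0r !star0 mul0l.
- by rewrite mul0l !star0 mul0r.
Qed.

HB.instance Definition _ := GRing.Lmodule.copy (crossed act) (tens A H).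
HB.instance Definition _ := isStarAlg.Build R (crossed act)
  mul_bilin mulA star_antilinear starK starM.

End Crossed.

Section InnerProducts.
Variables (R : realDomainType) (E : lmodType (cpx R)) (A : starAlgType R).

Definition right_module (act : E -> A -> E) : Prop :=
  [/\ bilin act,
      forall x a b, act x (a ** b) = act (act x a) b
    & forall u, is_unit_elt u -> forall x, act x u = x].

Definition left_module (act : A -> E -> E) : Prop :=
  [/\ bilin act,
      forall a b x, act (a ** b) x = act a (act b x)
    & forall u, is_unit_elt u -> forall x, act u x = x].

Definition right_inner_product (act : E -> A -> E) (ip : E -> E -> A) : Prop :=
  [/\ forall x, linear (ip x),
      forall c x x' y, ip (c *: x + x') y = cconj c *: ip x y + ip x' y,
      forall x y a, ip x (act y a) = ip x y ** a
    & forall x y, ip x y = sstar (ip y x)].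

Definition left_inner_product (act : A -> E -> E) (ip : E -> E -> A) : Prop :=
  [/\ forall y, linear (ip^~ y),
      forall c x y y', ip x (c *: y + y') = cconj c *: ip x y + ip x y',
      forall a x y, ip (act a x) y = a ** ip x y
    & forall x y, ip x y = sstar (ip y x)].

Definition nondegenerate_ip (ip : E -> E -> A) : Prop :=
  forall x, (forall y, ip x y = 0) -> x = 0.

Definition full_ip (ip : E -> E -> A) : Prop :=
  spanning (fun a : A => exists x y, a = ip x y).

Definition completely_positive (ip : E -> E -> A) : Prop :=
  forall n (x : 'I_n -> E),
    positive_elt (\matrix_(i, j) ip (x i) (x j) : starmx A n).

End InnerProducts.

Record equivalence_bimodule (R : realDomainType) (B A : starAlgType R) := {
  bim_sort :> lmodType (cpx R);
  lact : B -> bim_sort -> bim_sort;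
  ract : bim_sort -> A -> bim_sort;
  lip : bim_sort -> bim_sort -> B;
  rip : bim_sort -> bim_sort -> A;
  lact_module : left_module lact;
  ract_module : right_module ract;
  lract_assoc : forall b x a, ract (lact b x) a = lact b (ract x a);
  lact_span : spanning (fun z => exists b x, z = lact b x);
  ract_span : spanning (fun z => exists x a, z = ract x a);
  lip_inner : left_inner_product lact lip;
  rip_inner : right_inner_product ract rip;
  lip_full : full_ip lip;
  rip_full : full_ip rip;
  lip_nondegenerate : nondegenerate_ip lip;
  rip_nondegenerate : nondegenerate_ip rip;
  rip_lact : forall b x y, rip (lact b x) y = rip x (lact (sstar b) y);
  lip_ract : forall x a y, lip (ract x a) y = lip x (ract y (sstar a));
  lip_rip : forall x y z, lact (lip x y) z = ract x (rip y z)
}.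

Definition strong_bimodule (R : realDomainType) (B A : starAlgType R)
    (E : equivalence_bimodule B A) : Prop :=
  completely_positive (@lip _ _ _ E) /\ completely_positive (@rip _ _ _ E).

(* Compatibility of [act] with [lact] and [ract] is not required: it follows from
   the two conditions on the inner products and their non-degeneracy. *)
Definition covariant_bimodule (R : realDomainType) (H : hopfStarType R)
    (B A : starAlgType R) (actB : star_action H B) (actA : star_action H A)
    (E : equivalence_bimodule B A) : Prop :=
  exists act : H -> E -> E,
    [/\ hopf_module act,
        forall g x y, actA g (rip x y) =
          tlift (fun g1 g2 => rip (act (hstar (antipode g1)) x) (act g2 y)) (comul g)
      & forall g x y, actB g (lip x y) =
          tlift (fun g1 g2 => lip (act g1 x) (act (hstar (antipode g2)) y)) (comul g)].

Section Morita.
Variables (R : realDomainType) (A B : starAlgType R).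

Definition star_Morita_equivalent : Prop := inhabited (equivalence_bimodule B A).

Definition strongly_Morita_equivalent : Prop :=
  exists E : equivalence_bimodule B A, strong_bimodule E.

Variables (H : hopfStarType R) (actA : star_action H A) (actB : star_action H B).

Definition covariantly_star_Morita_equivalent : Prop :=
  exists E : equivalence_bimodule B A, covariant_bimodule actB actA E.

Definition covariantly_strongly_Morita_equivalent : Prop :=
  exists E : equivalence_bimodule B A,
    strong_bimodule E /\ covariant_bimodule actB actA E.

End Morita.

(* Main.v *)
(* Let L be the linking *-algebra of a covariant equivalence bimodule E, with
   entries in B, E, the conjugate of E and A.  The compatible H-action on E makes
   L an algebra with a *-action of H, so that the crossed product of L by H is a
   *-algebra containing the crossed products of A and B as diagonal corners and
   E ⊗ H as an off-diagonal one; all algebraic identities required of E ⊗ H are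
   instances of associativity there.  The ground ring need not be a field, so the
   inner products on E ⊗ H may be degenerate; non-degeneracy of the crossed
   products makes their two radicals equal, and the quotient by the radical is
   the desired bimodule.  For complete positivity, one has
   (x ⊗ g)^* (y ⊗ h) = (1 ⊗ g)^* (x^* y ⊗ 1) (1 ⊗ h), and a positive functional
   on matrices over the crossed product composed with the compression
   a |-> (1 ⊗ g)^* (a ⊗ 1) (1 ⊗ h) is a positive functional on matrices over A. *)

Require Import Defs.
From HB Require Import structures.
From mathcomp Require Import all_boot all_order all_algebra.
From mathcomp Require Import generic_quotient boolp.

Set Implicit Arguments.
Unset Strict Implicit.
Unset Printing Implicit Defensive.

Import GRing.Theory Num.Theory.
Local Open Scope ring_scope.

(** * Quotient modules *)

(** Membership is [Prop]-valued because the radical to be divided out is given by universally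
    quantified equations. *)
Record submodule (K : pzRingType) (V : lmodType K) := Submodule {
  submodule_mem :> V -> Prop;
  submodule0 : submodule_mem 0;
  submoduleP : forall c x y,
    submodule_mem x -> submodule_mem y -> submodule_mem (c *: x + y)
}.

Section QuotientModule.
Variables (K : pzRingType) (V : lmodType K) (N : submodule V).

Definition quotmod_rel (x y : V) : bool := `[< N (x - y) >].

Let sub_scale c x : N x -> N (c *: x).
Proof. by move=> Nx; rewrite -[c *: x]addr0; apply: submoduleP (submodule0 N). Qed.

Let sub_add x y : N x -> N y -> N (x + y).
Proof. by move=> Nx Ny; rewrite -[x]scale1r; apply: submoduleP. Qed.

Let rel_refl : reflexive quotmod_rel.
Proof. by move=> x; apply/asboolP; rewrite subrr; apply: submodule0. Qed.

Let rel_sym : symmetric quotmod_rel.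
Proof.
have h x y : N (x - y) -> N (y - x) by move/(sub_scale (-1)); rewrite scaleN1r opprB.
by move=> x y; apply: asbool_equiv_eq; split; apply: h.
Qed.

Let rel_trans : transitive quotmod_rel.
Proof.
move=> y x z /asboolP xy /asboolP yz; apply/asboolP.
by rewrite -(subrK y x) -addrA; apply: sub_add.
Qed.

Canonical quotmod_equiv := EquivRel quotmod_rel rel_refl rel_sym rel_trans.

Definition quotmod : Type := {eq_quot quotmod_equiv}%qT.

HB.instance Definition _ := Choice.on quotmod.

Local Open Scope quotient_scope.

Definition quotmod_class (x : V) : quotmod := \pi_({eq_quot quotmod_equiv}) x.
Definition quotmod_repr (q : quotmod) : V := repr (q : {eq_quot quotmod_equiv}).

Lemma quotmod_reprK q : quotmod_class (quotmod_repr q) = q.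
Proof. exact: reprK. Qed.

Lemma quotmod_classP x y : quotmod_class x = quotmod_class y <-> N (x - y).
Proof.
split; first by move/(@eqmodP _ quotmod_equiv) => /asboolP.
by move=> e; apply/(@eqmodP _ quotmod_equiv)/asboolP.
Qed.

Definition quotmod_add p q := quotmod_class (quotmod_repr p + quotmod_repr q).
Definition quotmod_scale c q := quotmod_class (c *: quotmod_repr q).
Definition quotmod_opp q := quotmod_scale (-1) q.

Let repr_class x : N (quotmod_repr (quotmod_class x) - x).
Proof. by apply/quotmod_classP; rewrite quotmod_reprK. Qed.

Let class_add x y :
  quotmod_add (quotmod_class x) (quotmod_class y) = quotmod_class (x + y).
Proof.
by apply/quotmod_classP; rewrite opprD addrACA; apply: sub_add; apply: repr_class.
Qed.

Let class_scale c x : quotmod_scale c (quotmod_class x) = quotmod_class (c *: x).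
Proof. by apply/quotmod_classP; rewrite -scalerBr; apply: sub_scale. Qed.

Lemma quotmod_ind (P : quotmod -> Prop) :
  (forall x, P (quotmod_class x)) -> forall q, P q.
Proof. by move=> h q; rewrite -[q]quotmod_reprK. Qed.

Let addA : associative quotmod_add.
Proof. by do 3![elim/quotmod_ind => ?]; rewrite !class_add addrA. Qed.

Let addC : commutative quotmod_add.
Proof. by do 2![elim/quotmod_ind => ?]; rewrite !class_add addrC. Qed.

Let add0 : left_id (quotmod_class 0) quotmod_add.
Proof. by elim/quotmod_ind => x; rewrite class_add add0r. Qed.

Let addN : left_inverse (quotmod_class 0) quotmod_opp quotmod_add.
Proof.
by elim/quotmod_ind => x; rewrite /quotmod_opp class_scale class_add scaleN1r addNr.
Qed.

HB.instance Definition _ := GRing.isZmodule.Build quotmod addA addC add0 addN.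

Let scaleA c d q : quotmod_scale c (quotmod_scale d q) = quotmod_scale (c * d) q.
Proof. by elim/quotmod_ind: q => x; rewrite !class_scale scalerA. Qed.

Let scale1 : left_id 1 quotmod_scale.
Proof. by elim/quotmod_ind => x; rewrite class_scale scale1r. Qed.

Let classD x y : quotmod_class x + quotmod_class y = quotmod_class (x + y).
Proof. exact: class_add. Qed.

Let scaleDr : right_distributive quotmod_scale +%R.
Proof.
move=> c; do 2![elim/quotmod_ind => ?].
by rewrite classD !class_scale scalerDr classD.
Qed.

Let scaleDl (q : quotmod) : {morph quotmod_scale^~ q : c d / c + d}.
Proof. by move=> c d; elim/quotmod_ind: q => x; rewrite !class_scale scalerDl classD. Qed.

HB.instance Definition _ :=
  GRing.Zmodule_isLmodule.Build K quotmod scaleA scale1 scaleDr scaleDl.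

Let class_linear : linear quotmod_class.
Proof. by move=> c x y; rewrite -classD -class_scale. Qed.

HB.instance Definition _ := GRing.isLinear.Build K V quotmod _ quotmod_class class_linear.

Lemma quotmod_class_eq0 x : quotmod_class x = 0 <-> N x.
Proof. by rewrite -[0]/(quotmod_class 0) quotmod_classP subr0. Qed.

End QuotientModule.

(** * Bimodules from corners of a *-algebra *)

Lemma spanning_ind (K : pzRingType) (V : lmodType K) (P Q : V -> Prop) :
  spanning P -> Q 0 -> (forall c x y, P x -> Q y -> Q (c *: x + y)) ->
  forall v, Q v.
Proof.
move=> sP Q0 QP v; have [s [Ps ->]] := sP v.
elim: s Ps => [|p s IH] Ps; first by rewrite big_nil.
rewrite big_cons; apply: QP; first by apply: Ps; rewrite inE eqxx.
by apply: IH => q qs; apply: Ps; rewrite inE qs orbT.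
Qed.

Lemma spanning_image (K : pzRingType) (U V : lmodType K) (f : {linear U -> V})
    (P : U -> Prop) (Q : V -> Prop) :
  (forall v, exists u, v = f u) -> (forall u, P u -> Q (f u)) ->
  spanning P -> spanning Q.
Proof.
move=> f_onto PQ sP v; have [u ->] := f_onto v; have [s [Ps ->]] := sP u.
exists [seq (p.1, f p.2) | p <- s]; split.
  by move=> _ /mapP[p ps ->]; apply/PQ/Ps.
by rewrite big_map linear_sum; apply: eq_bigr => p _; rewrite linearZ.
Qed.

(** Serves for [f] the action of a unit: it fixes each product of an algebra element and a vector,
    and these span. *)
Lemma spanning_fix (K : pzRingType) (V : lmodType K) (f : V -> V) (P : V -> Prop) :
  linear f -> spanning P -> (forall v, P v -> f v = v) -> forall v, f v = v.
Proof.
move=> fl sP fP; apply: (spanning_ind sP) => [|c x y /fP fx fy].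
  by apply: (addrI (f 0)); rewrite -{1}[f 0]scale1r -fl scaler0 !addr0.
by rewrite fl fx fy.
Qed.

Section Corner.
Variables (R : realDomainType) (M B A : starAlgType R) (E : lmodType (cpx R)).
(** [B], [A] and [E] sit in [M] like the diagonal corners and one off-diagonal corner of block
    matrices, but no projections in [M] are assumed. Identities are checked after applying an
    injection, where they follow from associativity and the star rules of [M]. *)
Variables (iB : {linear B -> M}) (iA : {linear A -> M}) (iE : {linear E -> M}).
Hypotheses (iB_inj : injective iB) (iA_inj : injective iA) (iE_inj : injective iE).
Hypotheses (iB_mul : {morph iB : a b / a ** b}) (iA_mul : {morph iA : a b / a ** b}).
Hypotheses (iB_star : {morph iB : a / sstar a}) (iA_star : {morph iA : a / sstar a}).
Variables (lact : B -> E -> E) (ract : E -> A -> E).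
Variables (lip : E -> E -> B) (rip : E -> E -> A).
Hypotheses (lactE : forall b x, iE (lact b x) = iB b ** iE x).
Hypotheses (ractE : forall x a, iE (ract x a) = iE x ** iA a).
Hypotheses (lipE : forall x y, iB (lip x y) = iE x ** sstar (iE y)).
Hypotheses (ripE : forall x y, iA (rip x y) = sstar (iE x) ** iE y).
Hypotheses (lact_sp : spanning (fun z => exists b x, z = lact b x)).
Hypotheses (ract_sp : spanning (fun z => exists x a, z = ract x a)).
Hypotheses (lip_sp : full_ip lip) (rip_sp : full_ip rip).
Hypotheses (ndB : nondegenerate_alg B) (ndA : nondegenerate_alg A).

Let mulE := (linearP, smulDl, smulDr, smulZl, smulZr, sstarD, sstarZ).

Let lact_linl x : linear (lact^~ x).
Proof. by move=> c a b; apply: iE_inj; rewrite lactE !mulE !lactE. Qed.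

Let lact_linr b : linear (lact b).
Proof. by move=> c x y; apply: iE_inj; rewrite lactE !mulE !lactE. Qed.

Let ract_linl a : linear (ract^~ a).
Proof. by move=> c x y; apply: iE_inj; rewrite ractE !mulE !ractE. Qed.

Let ract_linr x : linear (ract x).
Proof. by move=> c a b; apply: iE_inj; rewrite ractE !mulE !ractE. Qed.

Let lip_linl y : linear (lip^~ y).
Proof. by move=> c x x'; apply: iB_inj; rewrite lipE !mulE !lipE. Qed.

Let rip_linr x : linear (rip x).
Proof. by move=> c y y'; apply: iA_inj; rewrite ripE !mulE !ripE. Qed.

Let lip_antir c x y y' : lip x (c *: y + y') = cconj c *: lip x y + lip x y'.
Proof. by apply: iB_inj; rewrite lipE !mulE !lipE. Qed.

Let rip_antil c x x' y : rip (c *: x + x') y = cconj c *: rip x y + rip x' y.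
Proof. by apply: iA_inj; rewrite ripE !mulE !ripE. Qed.

Let lip_sym x y : lip x y = sstar (lip y x).
Proof. by apply: iB_inj; rewrite iB_star !lipE sstarM sstarK. Qed.

Let rip_sym x y : rip x y = sstar (rip y x).
Proof. by apply: iA_inj; rewrite iA_star !ripE sstarM sstarK. Qed.

Let lactM a b x : lact (a ** b) x = lact a (lact b x).
Proof. by apply: iE_inj; rewrite !lactE iB_mul smulA. Qed.

Let ractM x a b : ract x (a ** b) = ract (ract x a) b.
Proof. by apply: iE_inj; rewrite !ractE iA_mul smulA. Qed.

Let lact_ract b x a : ract (lact b x) a = lact b (ract x a).
Proof. by apply: iE_inj; rewrite lactE !ractE lactE smulA. Qed.

Let lip_lact b x y : lip (lact b x) y = b ** lip x y.
Proof. by apply: iB_inj; rewrite iB_mul !lipE lactE smulA. Qed.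

Let rip_ract x y a : rip x (ract y a) = rip x y ** a.
Proof. by apply: iA_inj; rewrite iA_mul !ripE ractE smulA. Qed.

Let rip_lact b x y : rip (lact b x) y = rip x (lact (sstar b) y).
Proof. by apply: iA_inj; rewrite !ripE !lactE sstarM iB_star smulA. Qed.

Let lip_ract x a y : lip (ract x a) y = lip x (ract y (sstar a)).
Proof. by apply: iB_inj; rewrite !lipE !ractE sstarM iA_star sstarK smulA. Qed.

Let lip_rip x y z : lact (lip x y) z = ract x (rip y z).
Proof. by apply: iE_inj; rewrite lactE ractE lipE ripE smulA. Qed.

Let lact0 x : lact 0 x = 0.
Proof. by apply: iE_inj; rewrite lactE !linear0 smul0l. Qed.

Let ract0 x : ract x 0 = 0.
Proof. by apply: iE_inj; rewrite ractE !linear0 smul0r. Qed.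

Let rip0r x : rip x 0 = 0.
Proof. by apply: iA_inj; rewrite ripE !linear0 smul0r. Qed.

Let rip0l x : rip 0 x = 0.
Proof. by rewrite rip_sym rip0r sstar0. Qed.

Let rad_closed c x y : (forall z, rip x z = 0) -> (forall z, rip y z = 0) ->
  forall z, rip (c *: x + y) z = 0.
Proof. by move=> hx hy z; rewrite rip_antil hx hy scaler0 addr0. Qed.

Let rad : submodule E := Submodule rip0l rad_closed.

Let lip0l y : lip 0 y = 0.
Proof. by apply: iB_inj; rewrite lipE !linear0 smul0l. Qed.

(** By fullness of [lip] and non-degeneracy of [B] it suffices that [lip u v ** lip x y = 0]. This
    product is [lip (ract u (rip v x)) y], and [rip v x] vanishes by symmetry. *)
Let lip_eq0 x : (forall y, rip x y = 0) -> forall y, lip x y = 0.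
Proof.
move=> hx y; apply: ndB.2.
apply: (spanning_ind lip_sp) => [|c _ b' [u [v ->]] e]; first exact: smul0l.
rewrite smulDl smulZl e addr0 -lip_lact lip_rip rip_sym hx sstar0.
by rewrite ract0 lip0l scaler0.
Qed.

(** The mirror argument uses [rip y x ** rip u v = rip y (lact (lip x u) v)]. With [lip_eq0], the
    two radicals coincide. *)
Let rip_eq0 x : (forall y, lip x y = 0) -> forall y, rip x y = 0.
Proof.
move=> hx y; rewrite rip_sym; suff ->: rip y x = 0 by apply: sstar0.
apply: ndA.1; apply: (spanning_ind rip_sp) => [|c _ a [u [v ->]] e]; first exact: smul0r.
by rewrite smulDr smulZr e addr0 -rip_ract -lip_rip hx lact0 rip0r scaler0.
Qed.

Let E' := quotmod rad.
Let p : {linear E -> E'} := @quotmod_class _ _ rad.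

Let p_onto (q : E') : exists x, q = p x.
Proof. by exists (quotmod_repr q); rewrite /p /= quotmod_reprK. Qed.

(** The chosen representative of [p x] differs from [x] by an element of the radical, which [f] does
    not see. *)
Let lift_p (W : zmodType) (f : E -> W) (x : E) :
  {morph f : u v / u - v} -> (forall u, rad u -> f u = 0) ->
  f (quotmod_repr (p x)) = f x.
Proof.
move=> fB f0; apply/eqP; rewrite -subr_eq0 -fB; apply/eqP/f0/quotmod_classP.
exact: quotmod_reprK.
Qed.

Let lact' b (q : E') : E' := p (lact b (quotmod_repr q)).
Let ract' (q : E') a : E' := p (ract (quotmod_repr q) a).
Let lip' (q r : E') : B := lip (quotmod_repr q) (quotmod_repr r).
Let rip' (q r : E') : A := rip (quotmod_repr q) (quotmod_repr r).

Let linB (V W : lmodType (cpx R)) (f : V -> W) :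
  linear f -> {morph f : u v / u - v}.
Proof.
move=> fl u v; have := fl (-1) v u.
by rewrite !scaleN1r [- v + u]addrC [- f v + _]addrC.
Qed.

(** The radical is stable under [B], as [b] moves to the other argument of [rip] as [sstar b]. *)
Let lactp b x : lact' b (p x) = p (lact b x).
Proof.
apply: (lift_p (f := fun x => p (lact b x))) => [u v|u ru].
  by rewrite (linB (lact_linr b)) raddfB.
by apply/quotmod_class_eq0 => z; rewrite rip_lact ru.
Qed.

Let ractp x a : ract' (p x) a = p (ract x a).
Proof.
apply: (lift_p (f := fun x => p (ract x a))) => [u v|u ru].
  by rewrite (linB (ract_linl a)) raddfB.
by apply/quotmod_class_eq0 => z; rewrite rip_sym rip_ract rip_sym ru sstar0 smul0l sstar0.
Qed.

Let sstarB (C : starAlgType R) : {morph (@sstar R C) : a b / a - b}.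
Proof. by move=> a b; rewrite -scaleN1r sstarD sstarZ rmorphN1 scaleN1r. Qed.

Let lipp x y : lip' (p x) (p y) = lip x y.
Proof.
rewrite /lip' (lift_p (f := lip^~ _)); last by move=> u ru; apply: lip_eq0.
  rewrite (lift_p (f := lip x)) // => [u v|u ru].
    by rewrite lip_sym (linB (lip_linl x)) sstarB -!lip_sym.
  by rewrite lip_sym lip_eq0 ?sstar0.
exact: linB (lip_linl _).
Qed.

Let ripp x y : rip' (p x) (p y) = rip x y.
Proof.
rewrite /rip' (lift_p (f := rip^~ _)); last by move=> u ru; apply: ru.
  rewrite (lift_p (f := rip x)) // => [|u ru]; first exact: linB (rip_linr _).
  by rewrite rip_sym ru sstar0.
by move=> u v; rewrite rip_sym (linB (rip_linr _)) sstarB -!rip_sym.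
Qed.

Let pE := (lactp, ractp, lipp, ripp).

(** The bimodule is the quotient of [E] by the common radical. The surjection [q] belongs to the
    conclusion so that complete positivity can later be tested on elements of [E]. *)
Lemma corner_bimodule : exists (Q : equivalence_bimodule B A) (q : E -> Q),
  [/\ forall z, exists x, z = q x,
      forall x y, Defs.lip (q x) (q y) = lip x y
    & forall x y, Defs.rip (q x) (q y) = rip x y].
Proof.
(* Since [p] is onto, each axiom is checked on classes [p x], where it becomes an identity in
   [E]. *)
have lmod : left_module lact'.
  split.
  - split=> [q c a b|b c q r].
      by have [x ->] := p_onto q; rewrite !pE lact_linl linearP.
    have [[x ->] [y ->]] := (p_onto q, p_onto r).
    by rewrite -linearP !pE lact_linr linearP.
  - by move=> a b q; have [x ->] := p_onto q; rewrite !pE lactM.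
  - move=> u hu q; have [x ->] := p_onto q; rewrite pE; congr (p _); move: x.
    apply: (spanning_fix (lact_linr u) lact_sp) => _ [a [z ->]].
    by rewrite -lactM (hu a).1.
have rmod : right_module ract'.
  split.
  - split=> [a c q r|q c a b].
      have [[x ->] [y ->]] := (p_onto q, p_onto r).
      by rewrite -linearP !pE ract_linl linearP.
    by have [x ->] := p_onto q; rewrite !pE ract_linr linearP.
  - by move=> q a b; have [x ->] := p_onto q; rewrite !pE ractM.
  - move=> u hu q; have [x ->] := p_onto q; rewrite pE; congr (p _); move: x.
    apply: (spanning_fix (ract_linl u) ract_sp) => _ [z [a ->]].
    by rewrite -ractM (hu a).2.
have lra b q a : ract' (lact' b q) a = lact' b (ract' q a).
  by have [x ->] := p_onto q; rewrite !pE lact_ract.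
have lsp : spanning (fun z => exists b q, z = lact' b q).
  apply: spanning_image p_onto _ lact_sp => _ [b [x ->]].
  by exists b, (p x); rewrite pE.
have rsp : spanning (fun z => exists q a, z = ract' q a).
  apply: spanning_image p_onto _ ract_sp => _ [x [a ->]].
  by exists (p x), a; rewrite pE.
have linn : left_inner_product lact' lip'.
  split.
  - move=> r c q q'; have [x ->] := p_onto q.
    have [[x' ->] [y ->]] := (p_onto q', p_onto r).
    by rewrite -linearP !pE lip_linl.
  - move=> c r q q'; have [x ->] := p_onto q.
    have [[x' ->] [y ->]] := (p_onto q', p_onto r).
    by rewrite -linearP !pE lip_antir.
  - move=> b q r; have [[x ->] [y ->]] := (p_onto q, p_onto r).
    by rewrite !pE lip_lact.
  - by move=> q r; have [[x ->] [y ->]] := (p_onto q, p_onto r); rewrite !pE lip_sym.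
have rinn : right_inner_product ract' rip'.
  split.
  - move=> r c q q'; have [x ->] := p_onto q.
    have [[x' ->] [y ->]] := (p_onto q', p_onto r).
    by rewrite -linearP !pE rip_linr.
  - move=> c q q' r; have [x ->] := p_onto q.
    have [[x' ->] [y ->]] := (p_onto q', p_onto r).
    by rewrite -linearP !pE rip_antil.
  - move=> q r a; have [[x ->] [y ->]] := (p_onto q, p_onto r).
    by rewrite !pE rip_ract.
  - by move=> q r; have [[x ->] [y ->]] := (p_onto q, p_onto r); rewrite !pE rip_sym.
have lfull : full_ip lip'.
  move=> b; have [s [hs e]] := lip_sp b; exists s; split=> // t /hs[x [y ->]].
  by exists (p x), (p y); rewrite pE.
have rfull : full_ip rip'.
  move=> a; have [s [hs e]] := rip_sp a; exists s; split=> // t /hs[x [y ->]].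
  by exists (p x), (p y); rewrite pE.
(* A vector in the radical of [lip] is by [rip_eq0] in that of [rip], which is the submodule divided
   out. *)
have lnd : nondegenerate_ip lip'.
  move=> q; have [x ->] := p_onto q => h; apply/quotmod_class_eq0/rip_eq0 => y.
  by rewrite -lipp.
have rnd : nondegenerate_ip rip'.
  move=> q; have [x ->] := p_onto q => h; apply/quotmod_class_eq0 => y.
  by rewrite -ripp.
have rl b q r : rip' (lact' b q) r = rip' q (lact' (sstar b) r).
  by have [[x ->] [y ->]] := (p_onto q, p_onto r); rewrite !pE rip_lact.
have lr q a r : lip' (ract' q a) r = lip' q (ract' r (sstar a)).
  by have [[x ->] [y ->]] := (p_onto q, p_onto r); rewrite !pE lip_ract.
have lrip q r s : lact' (lip' q r) s = ract' q (rip' r s).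
  have [[x ->] [y ->] [z ->]] := And3 (p_onto q) (p_onto r) (p_onto s).
  by rewrite !pE lip_rip.
exists (Build_equivalence_bimodule lmod rmod lra lsp rsp linn rinn lfull rfull
  lnd rnd rl lr lrip), p.
by split; [exact: p_onto | exact: lipp | exact: ripp].
Qed.

End Corner.

(** * Covariance of the module structures *)

Section Bilinear.
Variables (K : pzRingType) (U V W : lmodType K) (f : U -> V -> W).
Hypothesis bf : bilin f.

Lemma bilinDl v : {morph f^~ v : x y / x + y}.
Proof. by move=> x y; have := bf.1 v 1 x y; rewrite !scale1r. Qed.

Lemma bilinDr u : {morph f u : x y / x + y}.
Proof. by move=> x y; have := bf.2 u 1 x y; rewrite !scale1r. Qed.

Lemma bilin0l v : f 0 v = 0.
Proof. by apply: (addrI (f 0 v)); rewrite -bilinDl !addr0. Qed.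

Lemma bilin0r u : f u 0 = 0.
Proof. by apply: (addrI (f u 0)); rewrite -bilinDr !addr0. Qed.

Lemma bilinZl c u v : f (c *: u) v = c *: f u v.
Proof. by have := bf.1 v c u 0; rewrite bilin0l !addr0. Qed.

Lemma bilinZr c u v : f u (c *: v) = c *: f u v.
Proof. by have := bf.2 u c v 0; rewrite bilin0r !addr0. Qed.

End Bilinear.

(** * The antipode and its composite with the star *)

Section Antipode.
Variables (R : realDomainType) (H : hopfStarType R).
Implicit Types g h : H.

Lemma antipode1 : antipode 1 = 1 :> H.
Proof.
have bS : balanced (fun x y : H => antipode x * y).
  split=> [v x y|u x y|c u v]; rewrite ?raddfD ?mulrDl ?mulrDr //=.
  by rewrite linearZ /= -scalerAl -scalerAr.
have := antipodel (1 : H); rewrite comul1 (tlift_pure bS) mulr1 => ->.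
by rewrite counitM.1 scale1r.
Qed.

Lemma antipodeZ c g : antipode (c *: g) = c *: antipode g.
Proof. exact: linearZ. Qed.

Lemma antipodeD : {morph @antipode R H : g h / g + h}.
Proof. exact: raddfD. Qed.

(* Both sides equal the sum of [S(g1 h1) g2 h2 S(h3) S(g3)]. *)
Lemma antipodeM g h : antipode (g * h) = antipode h * antipode g.
Proof.
pose F u v z m n r : H := antipode (u * m) * (v * n) * (antipode r * antipode z).
have add := (mulrDl, mulrDr, antipodeD).
have scl := (fun k (a b : H) => esym (scalerAl k a b),
  fun k (a b : H) => esym (scalerAr k a b), antipodeZ).
have bF1 u v z : tribalanced (F u v z).
  by split=> ? ? ? ? /=; rewrite /F ?add // ?scl //.
have bF2 m n r : tribalanced (fun u v z => F u v z m n r).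
  by split=> ? ? ? ? /=; rewrite /F ?add // ?scl //.
have bS : balanced (fun x y : H => antipode x * y).
  by split=> ? ? ? /=; rewrite ?add // ?scl //.
have hl a : {morph (fun x : H => x * a) : x y / x + y} by move=> x y; rewrite mulrDl.
have hr a : {morph (fun x : H => a * x) : x y / x + y} by move=> x y; rewrite mulrDr.
transitivity (tlift (fun x z => tlift (fun p r => tlift (fun u v =>
  tlift (fun m n => F u v z m n r) (comul p)) (comul x)) (comul h)) (comul g)); last first.
  (* The factor [S(u m) (v n)] is the antipode axiom for the product [x * p], so it contracts to a
     product of counits. *)
  have e x z p r : tlift (fun u v => tlift (fun m n => F u v z m n r) (comul p)) (comul x)
      = antipode (counit p *: r) * antipode (counit x *: z).
    under eq_tlift => u v do rewrite -(tlift_morph (hl _)).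
    rewrite -(tlift_morph (hl _)) -(sweedlerM bS) antipodel counitM.2.
    by rewrite !scl mul1r scalerA mulrC.
  rewrite -[in RHS](counitl g) (tlift_morph antipodeD) (tlift_morph (hr _)).
  apply: eq_tlift => x z; rewrite -[in RHS](counitl h) (tlift_morph antipodeD).
  by rewrite (tlift_morph (hl _)); apply: eq_tlift => p r; rewrite e.
(* The left-hand side takes two contractions: [h2 S(h3)] turns the sum of [F] into that of [G], and
   [g2 S(g3)] turns the latter into [S(g h)]. *)
pose G u v z := antipode (u * h) * v * antipode z.
have bG : tribalanced G by split=> ? ? ? ? /=; rewrite /G ?add // ?scl //.
transitivity (tlift (fun x z => tlift (fun u v => G u v z) (comul x)) (comul g)).
  rewrite (sweedlerA bG) -[in LHS](counitr g) (tlift_morph (hl _)) (tlift_morph antipodeD).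
  apply: eq_tlift => x z; rewrite !scl.
  under eq_tlift => v w do rewrite /G -mulrA.
  by rewrite -(tlift_morph (hr _)) antipoder scl mulr1.
apply: eq_tlift => x z; rewrite tlift_exchange; apply: eq_tlift => u v.
rewrite (sweedlerA (bF1 u v z)) /G -[in LHS](counitr h) (tlift_morph (hr _)).
rewrite (tlift_morph antipodeD) !(tlift_morph (hl _)); apply: eq_tlift => p r.
rewrite !scl.
under eq_tlift => m n do rewrite /F !mulrA -[_ * m * _]mulrA -[_ * (m * _)]mulrA.
by rewrite -(tlift_morph (hl _)) -!(tlift_morph (hr _)) antipoder !scl mulr1.
Qed.

(** An antilinear involution, multiplicative because [antipode] and [hstar] both reverse products.
    It describes how [H] acts on adjoints. *)
Definition star_antipode g : H := hstar (antipode g).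

Lemma star_antipodeK : involutive star_antipode. Proof. exact: antipode_star. Qed.

Lemma star_antipodeD : {morph star_antipode : g h / g + h}.
Proof. by move=> g h; rewrite /star_antipode raddfD /= hstarD. Qed.

Lemma star_antipodeZ c g : star_antipode (c *: g) = cconj c *: star_antipode g.
Proof. by rewrite /star_antipode linearZ /= hstarZ. Qed.

End Antipode.

Local Notation σ := star_antipode.

(** * Sesquilinearity and cancellation in an equivalence bimodule *)

Section Bimodule.
Variables (R : realDomainType) (B A : starAlgType R) (E : equivalence_bimodule B A).
Implicit Types (x y z : E) (a : A) (b : B).

Lemma lact_bilin : bilin (@lact _ _ _ E). Proof. by case: (lact_module E). Qed.
Lemma ract_bilin : bilin (@ract _ _ _ E). Proof. by case: (ract_module E). Qed.

Lemma lactM b b' x : lact (b ** b') x = lact b (lact b' x).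
Proof. by case: (lact_module E). Qed.

Lemma ractM x a a' : ract x (a ** a') = ract (ract x a) a'.
Proof. by case: (ract_module E). Qed.

Lemma lip_sym x y : lip x y = sstar (lip y x).
Proof. by case: (lip_inner E). Qed.

Lemma rip_sym x y : rip x y = sstar (rip y x).
Proof. by case: (rip_inner E). Qed.

Lemma lip_lactl b x y : lip (lact b x) y = b ** lip x y.
Proof. by case: (lip_inner E). Qed.

Lemma rip_ractr x y a : rip x (ract y a) = rip x y ** a.
Proof. by case: (rip_inner E). Qed.

Lemma lip_lactr b x y : lip x (lact b y) = lip x y ** sstar b.
Proof. by rewrite lip_sym lip_lactl sstarM -lip_sym. Qed.

Lemma rip_ractl a x y : rip (ract x a) y = sstar a ** rip x y.
Proof. by rewrite rip_sym rip_ractr sstarM -rip_sym. Qed.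

Lemma lipDl y : {morph (@lip _ _ _ E)^~ y : x x' / x + x'}.
Proof.
by case: (lip_inner E) => l _ _ _ x x'; have := l y 1 x x'; rewrite !scale1r.
Qed.

Lemma ripDr x : {morph @rip _ _ _ E x : y y' / y + y'}.
Proof.
by case: (rip_inner E) => l _ _ _ y y'; have := l x 1 y y'; rewrite !scale1r.
Qed.

Lemma lipDr x : {morph @lip _ _ _ E x : y y' / y + y'}.
Proof. by move=> y y'; rewrite lip_sym lipDl sstarD -!lip_sym. Qed.

Lemma ripDl y : {morph (@rip _ _ _ E)^~ y : x x' / x + x'}.
Proof. by move=> x x'; rewrite rip_sym ripDr sstarD -!rip_sym. Qed.

Lemma lip0l y : lip 0 y = 0 :> B.
Proof. by apply: (addrI (lip (0 : E) y)); rewrite -lipDl !addr0. Qed.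

Lemma lip0r x : lip x 0 = 0 :> B.
Proof. by rewrite lip_sym lip0l sstar0. Qed.

Lemma rip0r x : rip x 0 = 0 :> A.
Proof. by apply: (addrI (rip x (0 : E))); rewrite -ripDr !addr0. Qed.

Lemma rip0l y : rip 0 y = 0 :> A.
Proof. by rewrite rip_sym rip0r sstar0. Qed.

Lemma lipZl c x y : lip (c *: x) y = c *: lip x y.
Proof.
by case: (lip_inner E) => l _ _ _; have := l y c x 0; rewrite !addr0 lip0l addr0.
Qed.

Lemma ripZr c x y : rip x (c *: y) = c *: rip x y.
Proof.
by case: (rip_inner E) => l _ _ _; have := l x c y 0; rewrite !addr0 rip0r addr0.
Qed.

Lemma lipZr c x y : lip x (c *: y) = cconj c *: lip x y.
Proof. by rewrite lip_sym lipZl sstarZ -lip_sym. Qed.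

Lemma ripZl c x y : rip (c *: x) y = cconj c *: rip x y.
Proof. by rewrite rip_sym ripZr sstarZ -rip_sym. Qed.

Lemma lip_inj y y' : (forall x, lip x y = lip x y') -> y = y'.
Proof.
move=> e; apply/eqP; rewrite -subr_eq0; apply/eqP/lip_nondegenerate => x.
by rewrite -scaleN1r lipDl lipZl scaleN1r [lip y x]lip_sym e -lip_sym subrr.
Qed.

Lemma rip_inj y y' : (forall x, rip x y = rip x y') -> y = y'.
Proof.
move=> e; apply/eqP; rewrite -subr_eq0; apply/eqP/rip_nondegenerate => x.
by rewrite rip_sym -scaleN1r ripDr ripZr scaleN1r e subrr sstar0.
Qed.

(** The vectors [lact b y] span [E] and [rip x (lact b y) = rip (lact (sstar b) x) y], so [x] lies
    in the radical of [rip]. *)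
Lemma lact_eq0 x : (forall b, lact b x = 0) -> x = 0.
Proof.
move=> hx; apply: rip_nondegenerate.
apply: (spanning_ind (@lact_span _ _ _ E)) => [|c _ z [b [y ->]] e]; first exact: rip0r.
by rewrite ripDr e addr0 ripZr -[b]sstarK -rip_lact hx rip0l scaler0.
Qed.

Lemma ract_eq0 x : (forall a, ract x a = 0) -> x = 0.
Proof.
move=> hx; apply: lip_nondegenerate.
apply: (spanning_ind (@ract_span _ _ _ E)) => [|c _ z [y [a ->]] e]; first exact: lip0r.
by rewrite lipDr e addr0 lipZr -[a]sstarK -lip_ract hx lip0l scaler0.
Qed.

End Bimodule.

Section Covariance.
Variables (R : realDomainType) (H : hopfStarType R) (B A : starAlgType R).
Variables (actB : star_action H B) (actA : star_action H A).
Variables (E : equivalence_bimodule B A) (act : H -> E -> E).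
Implicit Types (x y z : E) (a : A) (b : B) (g h : H).

Hypotheses (act_mod : hopf_module act)
  (act_rip : forall g x y, actA g (rip x y) =
     tlift (fun g1 g2 => rip (act (σ g1) x) (act g2 y)) (comul g))
  (act_lip : forall g x y, actB g (lip x y) =
     tlift (fun g1 g2 => lip (act g1 x) (act (σ g2) y)) (comul g)).

Let act_bilin : bilin act. Proof. by case: act_mod. Qed.
Let actM g h x : act (g * h) x = act g (act h x). Proof. by case: act_mod. Qed.
Let act1 x : act 1 x = x. Proof. by case: act_mod. Qed.
Let bA : bilin actA. Proof. by case: (sact_module actA). Qed.
Let bB : bilin actB. Proof. by case: (sact_module actB). Qed.
Let lE := lact_bilin E.
Let rE := ract_bilin E.

Let additive := (bilinDl act_bilin, bilinDr act_bilin, bilinDl bA, bilinDr bA,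
  bilinDl bB, bilinDr bB, bilinDl lE, bilinDr lE, bilinDl rE, bilinDr rE,
  lipDl, lipDr, ripDl, ripDr, smulDl, smulDr, star_antipodeD, hstarD,
  antipodeD, mulrDl, mulrDr).
Let scaling := (bilinZl act_bilin, bilinZr act_bilin, bilinZl bA, bilinZr bA,
  bilinZl bB, bilinZr bB, bilinZl lE, bilinZr lE, bilinZl rE, bilinZr rE,
  lipZl, lipZr, ripZl, ripZr, smulZl, smulZr, star_antipodeZ, hstarZ, antipodeZ,
  cconjK, fun k (g h : H) => esym (scalerAl k g h),
  fun k (g h : H) => esym (scalerAr k g h)).

(* [g1] cancels upon replacing [x] by [S^-1(g0) x], as [g1 S^-1(g0)] sums to the counit. *)
Let cancel_lip (D1 D2 : H -> E) :
  {morph D1 : g h / g + h} -> {morph D2 : g h / g + h} ->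
  (forall c g, D1 (c *: g) = cconj c *: D1 g) ->
  (forall c g, D2 (c *: g) = cconj c *: D2 g) ->
  (forall g x, tlift (fun g1 g2 => lip (act g1 x) (D1 g2)) (comul g) =
               tlift (fun g1 g2 => lip (act g1 x) (D2 g2)) (comul g)) ->
  forall g, D1 g = D2 g.
Proof.
move=> D1D D2D D1Z D2Z e g; apply: lip_inj => x.
(* One formula recovers both [D1 g] and [D2 g] from the pairing sums that the hypothesis equates. *)
suff cancel (D : H -> E) : {morph D : g h / g + h} ->
    (forall c g, D (c *: g) = cconj c *: D g) ->
    lip x (D g) = tlift (fun g1 g2 => tlift (fun h1 h2 =>
      lip (act h1 (act (σ (hstar g1)) x)) (D h2)) (comul g2)) (comul g).
  by rewrite !cancel //; apply: eq_tlift => g1 g2; apply: e.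
(* [σ (hstar h1)] is the inverse antipode of [h1], by [antipode_star]. *)
move=> DD DZ; pose F h1 h2 h3 : B := lip (act (h2 * σ (hstar h1)) x) (D h3).
have bF : tribalanced F.
  by split=> ? ? ? ? /=; rewrite /F ?DD ?DZ ?additive // ?scaling.
transitivity (tlift (fun g1 g2 => tlift (F g1) (comul g2)) (comul g)); last first.
  by apply: eq_tlift => g1 g2; apply: eq_tlift => h1 h2; rewrite /F actM.
rewrite -(sweedlerA bF) -[in LHS](counitl g) (tlift_morph DD) (tlift_morph (lipDr _)).
apply: eq_tlift => g1 g2; rewrite DZ lipZr cconjK /F.
rewrite -(tlift_morph (h := fun d => lip (act d x) (D g2))); last first.
  by move=> d d'; rewrite !additive.
by rewrite antipode_starl !scaling act1.
Qed.

(* [σ(g1)] cancels upon replacing [x] by [g0^* x], as [g0 S(g1)] sums to the counit. *)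
Let cancel_rip (D1 D2 : H -> E) :
  {morph D1 : g h / g + h} -> {morph D2 : g h / g + h} ->
  (forall c g, D1 (c *: g) = c *: D1 g) ->
  (forall c g, D2 (c *: g) = c *: D2 g) ->
  (forall g x, tlift (fun g1 g2 => rip (act (σ g1) x) (D1 g2)) (comul g) =
               tlift (fun g1 g2 => rip (act (σ g1) x) (D2 g2)) (comul g)) ->
  forall g, D1 g = D2 g.
Proof.
move=> D1D D2D D1Z D2Z e g; apply: rip_inj => x.
suff cancel (D : H -> E) : {morph D : g h / g + h} ->
    (forall c g, D (c *: g) = c *: D g) ->
    rip x (D g) = tlift (fun g1 g2 => tlift (fun h1 h2 =>
      rip (act (σ h1) (act (hstar g1) x)) (D h2)) (comul g2)) (comul g).
  by rewrite !cancel //; apply: eq_tlift => g1 g2; apply: e.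
move=> DD DZ; pose F h1 h2 h3 : A := rip (act (hstar (h1 * antipode h2)) x) (D h3).
have bF : tribalanced F.
  by split=> ? ? ? ? /=; rewrite /F ?DD ?DZ ?additive // ?scaling.
transitivity (tlift (fun g1 g2 => tlift (F g1) (comul g2)) (comul g)); last first.
  by apply: eq_tlift => g1 g2; apply: eq_tlift => h1 h2; rewrite /F hstarM actM.
rewrite -(sweedlerA bF) -[in LHS](counitl g) (tlift_morph DD) (tlift_morph (ripDr _)).
apply: eq_tlift => g1 g2; rewrite DZ ripZr /F.
rewrite -(tlift_morph (h := fun d => rip (act (hstar d) x) (D g2))); last first.
  by move=> d d'; rewrite !additive.
by rewrite antipoder !scaling hstar1 act1.
Qed.

Let sstar_act (C : starAlgType R) (actC : star_action H C) g c :
  sstar (actC g (sstar c)) = actC (σ g) c.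
Proof. by rewrite sact_star sstarK. Qed.

(** Paired with [act g1 x] in [lip], the left side becomes [g] acting on [lip x y ** sstar b], where
    the product rule in [B] applies; [cancel_lip] removes the pairing. The indices come out reversed
    because [b] leaves the second argument of [lip] on the right. *)
Lemma act_antipode_lact g b y : act (σ g) (lact b y) =
  tlift (fun g1 g2 => lact (actB (σ g2) b) (act (σ g1) y)) (comul g).
Proof.
have bf : balanced (fun g1 g2 => lact (actB (σ g2) b) (act (σ g1) y)).
  by split=> ? ? ? /=; rewrite ?additive // ?scaling.
move: g; apply: cancel_lip => [g h|g h|c g|c g|g x]; rewrite ?additive //.
- by rewrite raddfD (tliftD bf).
- by rewrite !scaling.
- rewrite linearZ /= (tliftZ bf) (tlift_morph (scalerDr _)).
  by apply: eq_tlift => g1 g2; rewrite !scaling.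
rewrite -act_lip lip_lactr sactM.
pose F h1 h2 h3 := lip (act h1 x) (lact (actB (σ h3) b) (act (σ h2) y)).
have bF : tribalanced F.
  by split=> ? ? ? ? /=; rewrite /F ?additive // ?scaling.
transitivity (tlift (fun g1 g2 => tlift (fun u v => F u v g2) (comul g1)) (comul g)).
  apply: eq_tlift => g1 g2; rewrite act_lip (tlift_morph (smulDl _)).
  apply: eq_tlift => h1 h2; rewrite /F lip_lactr; congr (_ ** _).
  by rewrite sact_star -/(σ _) star_antipodeK.
rewrite (sweedlerA bF); apply: eq_tlift => g1 g2.
by rewrite (tlift_morph (lipDr _)).
Qed.

(** Here the pairing is by [rip]. The factor [b] moves as [sstar b] into the first argument, on
    which [H] acts through [σ]; hence [act_antipode_lact] comes first. *)
Lemma act_lact g b y :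
  act g (lact b y) = tlift (fun g1 g2 => lact (actB g1 b) (act g2 y)) (comul g).
Proof.
have bf : balanced (fun g1 g2 => lact (actB g1 b) (act g2 y)).
  by split=> ? ? ? /=; rewrite ?additive // ?scaling.
move: g; apply: cancel_rip => [g h|g h|c g|c g|g x]; rewrite ?additive //.
- by rewrite raddfD (tliftD bf).
- by rewrite !scaling.
- rewrite linearZ /= (tliftZ bf) (tlift_morph (scalerDr _)).
  by apply: eq_tlift => g1 g2; rewrite !scaling.
rewrite -act_rip -[b]sstarK -rip_lact act_rip.
pose F h1 h2 h3 := rip (act (σ h1) x) (lact (actB h2 b) (act h3 y)).
have bF : tribalanced F.
  by split=> ? ? ? ? /=; rewrite /F ?additive // ?scaling.
transitivity (tlift (fun g1 g2 => tlift (fun u v => F u v g2) (comul g1)) (comul g)).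
  apply: eq_tlift => g1 g2; rewrite act_antipode_lact.
  rewrite (tlift_morph (ripDl _)); apply: eq_tlift => h1 h2.
  by rewrite rip_lact /F sstar_act star_antipodeK.
rewrite (sweedlerA bF); apply: eq_tlift => g1 g2.
by rewrite (tlift_morph (ripDr _)) sstarK.
Qed.

(** For the right action it is this version that follows directly, from the product rule for
    [rip x y ** a]. *)
Lemma act_ract g y a :
  act g (ract y a) = tlift (fun g1 g2 => ract (act g1 y) (actA g2 a)) (comul g).
Proof.
have bf : balanced (fun g1 g2 => ract (act g1 y) (actA g2 a)).
  by split=> ? ? ? /=; rewrite ?additive // ?scaling.
move: g; apply: cancel_rip => [g h|g h|c g|c g|g x]; rewrite ?additive //.
- by rewrite raddfD (tliftD bf).
- by rewrite !scaling.
- rewrite linearZ /= (tliftZ bf) (tlift_morph (scalerDr _)).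
  by apply: eq_tlift => g1 g2; rewrite !scaling.
rewrite -act_rip rip_ractr sactM.
pose F h1 h2 h3 := rip (act (σ h1) x) (ract (act h2 y) (actA h3 a)).
have bF : tribalanced F.
  by split=> ? ? ? ? /=; rewrite /F ?additive // ?scaling.
transitivity (tlift (fun g1 g2 => tlift (fun u v => F u v g2) (comul g1)) (comul g)).
  apply: eq_tlift => g1 g2; rewrite act_rip (tlift_morph (smulDl _)).
  by apply: eq_tlift => h1 h2; rewrite /F rip_ractr.
rewrite (sweedlerA bF); apply: eq_tlift => g1 g2.
by rewrite (tlift_morph (ripDr _)).
Qed.

(** In [lip] the factor [a] moves as [sstar a] into the first argument, where [act_ract] applies. *)
Lemma act_antipode_ract g y a : act (σ g) (ract y a) =
  tlift (fun g1 g2 => ract (act (σ g2) y) (actA (σ g1) a)) (comul g).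
Proof.
have bf : balanced (fun g1 g2 => ract (act (σ g2) y) (actA (σ g1) a)).
  by split=> ? ? ? /=; rewrite ?additive // ?scaling.
move: g; apply: cancel_lip => [g h|g h|c g|c g|g x]; rewrite ?additive //.
- by rewrite raddfD (tliftD bf).
- by rewrite !scaling.
- rewrite linearZ /= (tliftZ bf) (tlift_morph (scalerDr _)).
  by apply: eq_tlift => g1 g2; rewrite !scaling.
rewrite -act_lip -[a]sstarK -lip_ract act_lip.
pose F h1 h2 h3 := lip (act h1 x) (ract (act (σ h3) y) (actA (σ h2) a)).
have bF : tribalanced F.
  by split=> ? ? ? ? /=; rewrite /F ?additive // ?scaling.
transitivity (tlift (fun g1 g2 => tlift (fun u v => F u v g2) (comul g1)) (comul g)).
  apply: eq_tlift => g1 g2; rewrite act_ract.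
  rewrite (tlift_morph (lipDl _)); apply: eq_tlift => h1 h2.
  by rewrite lip_ract /F sstar_act.
rewrite (sweedlerA bF); apply: eq_tlift => g1 g2.
by rewrite (tlift_morph (lipDr _)) sstarK.
Qed.

End Covariance.

(** * The linking algebra *)

(** Scalars act through conjugation, so that the adjoint of [y] depends linearly on
    [y : conjmod E]. *)
Definition conjmod (R : realDomainType) (V : lmodType (cpx R)) : Type := V.

Section ConjugateModule.
Variables (R : realDomainType) (V : lmodType (cpx R)).

HB.instance Definition _ := GRing.Zmodule.copy (conjmod V) V.

Definition conjmod_scale (c : cpx R) (v : conjmod V) : conjmod V := cconj c *: (v : V).

Let scaleA c d v : conjmod_scale c (conjmod_scale d v) = conjmod_scale (c * d) v.
Proof. by rewrite /conjmod_scale scalerA -rmorphM. Qed.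

Let scale1 : left_id 1 conjmod_scale.
Proof. by move=> v; rewrite /conjmod_scale rmorph1 scale1r. Qed.

Let scaleDr : right_distributive conjmod_scale +%R.
Proof. by move=> c u v; apply: scalerDr. Qed.

Let scaleDl v : {morph conjmod_scale^~ v : c d / c + d}.
Proof. by move=> c d; rewrite /conjmod_scale rmorphD; apply: scalerDl. Qed.

HB.instance Definition _ := GRing.Zmodule_isLmodule.Build (cpx R) (conjmod V)
  scaleA scale1 scaleDr scaleDl.

End ConjugateModule.

(* The element [(b, x, y, a)] stands for the block matrix [[b, x], [y^*, a]]. *)
Definition linking (R : realDomainType) (B A : starAlgType R)
  (E : equivalence_bimodule B A) : Type := (B * E * conjmod E * A)%type.

Section Linking.
Variables (R : realDomainType) (B A : starAlgType R) (E : equivalence_bimodule B A).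
Implicit Types l m : linking E.

HB.instance Definition _ := GRing.Lmodule.copy (linking E) (B * E * conjmod E * A)%type.

Definition linking_elt (b : B) (x : E) (y : conjmod E) (a : A) : linking E :=
  (b, x, y, a).

Lemma linking_eltP c b x y a b' x' y' a' :
  c *: linking_elt b x y a + linking_elt b' x' y' a' =
  linking_elt (c *: b + b') (c *: x + x') (c *: y + y') (c *: a + a').
Proof. by []. Qed.

(** The lower left entry [y^* b' + a y'^*] of the matrix product is stored through its adjoint
    [b'^* y + y' a^*]. *)
Definition linking_mul l m : linking E :=
  let: (b, x, y, a) := l in let: (b', x', y', a') := m in
  linking_elt (b ** b' + lip x (y' : E)) (lact b x' + ract x a')
    (lact (sstar b') (y : E) + ract (y' : E) (sstar a)) (rip (y : E) x' + a ** a').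

Definition linking_star l : linking E :=
  let: (b, x, y, a) := l in linking_elt (sstar b) y x (sstar a).

Let lE := lact_bilin E.
Let rE := ract_bilin E.
Let additive := (bilinDl lE, bilinDr lE, bilinDl rE, bilinDr rE,
  lipDl, lipDr, ripDl, ripDr, smulDl, smulDr, sstarD).
Let scaling := (bilinZl lE, bilinZr lE, bilinZl rE, bilinZr rE,
  lipZl, lipZr, ripZl, ripZr, smulZl, smulZr, sstarZ, cconjK).

Let mul_bilin : bilin linking_mul.
Proof.
split=> [[[[b' x'] y'] a'] c [[[b x] y] a] [[[b2 x2] y2] a2]
        |[[[b x] y] a] c [[[b' x'] y'] a'] [[[b2 x2] y2] a2]];
  rewrite -![(_, _, _, _)]/(linking_elt _ _ _ _) linking_eltP linking_eltP /=;
  congr (linking_elt _ _ _ _); rewrite /= ?additive ?scaling ?scalerDr addrACA //.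
Qed.

Let mulA : associative linking_mul.
Proof.
move=> [[[b x] y] a] [[[b1 x1] y1] a1] [[[b2 x2] y2] a2] /=.
(* Each entry is a sum of four triple products, matched by the compatibility axioms of the bimodule;
   [addrACA] swaps the middle two. *)
congr (linking_elt _ _ _ _); rewrite !additive ?smulA.
- by rewrite lip_lactl lip_lactr sstarK lip_ract addrACA.
- by rewrite lactM ractM lip_rip lract_assoc addrACA.
- rewrite sstarM sstarM lactM ractM -lip_sym -rip_sym lip_rip lract_assoc.
  by rewrite addrACA.
- by rewrite rip_ractr rip_ractl sstarK rip_lact sstarK addrACA.
Qed.

Let star_antilinear c l m :
  linking_star (c *: l + m) = cconj c *: linking_star l + linking_star m.
Proof.
case: l m => [[[b x] y] a] [[[b' x'] y'] a'].
rewrite -![(_, _, _, _)]/(linking_elt _ _ _ _) linking_eltP /=.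
rewrite linking_eltP; congr (linking_elt _ _ _ _); rewrite ?additive ?scaling //.
by rewrite /GRing.scale /= /conjmod_scale cconjK.
Qed.

Let starK : involutive linking_star.
Proof. by move=> [[[b x] y] a]; congr (linking_elt _ _ _ _); rewrite sstarK. Qed.

Let starM l m :
  linking_star (linking_mul l m) = linking_mul (linking_star m) (linking_star l).
Proof.
case: l m => [[[b x] y] a] [[[b' x'] y'] a'].
by congr (linking_elt _ _ _ _); rewrite ?additive ?sstarM -?lip_sym -?rip_sym ?sstarK.
Qed.

HB.instance Definition _ := isStarAlg.Build R (linking E)
  mul_bilin mulA star_antilinear starK starM.

Lemma linking_mulE b x (y : conjmod E) a b' x' (y' : conjmod E) a' :
  linking_elt b x y a ** linking_elt b' x' y' a' =
  linking_elt (b ** b' + lip x (y' : E)) (lact b x' + ract x a')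
    (lact (sstar b') (y : E) + ract (y' : E) (sstar a)) (rip (y : E) x' + a ** a').
Proof. by []. Qed.

Lemma linking_starE b x (y : conjmod E) a :
  sstar (linking_elt b x y a) = linking_elt (sstar b) y x (sstar a).
Proof. by []. Qed.

(** Products of the unit with diagonal matrices show that its off-diagonal entries are annihilated
    by all of [A] or all of [B]. This serves the condition on units in [star_action]. *)
Lemma linking_unit b x y a : is_unit_elt (linking_elt b x y a) ->
  [/\ is_unit_elt b, x = 0, y = 0 & is_unit_elt a].
Proof.
move=> hu; have cmp := (bilin0l lE, bilin0r lE, bilin0l rE, bilin0r rE, lip0l, lip0r,
  rip0l, rip0r, smul0l, smul0r, sstar0, addr0, add0r).
have hb b' : b ** b' = b' /\ lact (sstar b') (y : E) = 0.
  have := (hu (linking_elt b' 0 0 0)).1; rewrite linking_mulE !cmp.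
  by case.
have ha a' : a' ** a = a' /\ ract (y : E) (sstar a') = 0.
  have := (hu (linking_elt 0 0 0 a')).2; rewrite linking_mulE !cmp.
  by case.
have hb' b' : b' ** b = b' /\ lact b' x = 0.
  have := (hu (linking_elt b' 0 0 0)).2; rewrite linking_mulE !cmp.
  by case.
have ha' a' : a ** a' = a' /\ ract x a' = 0.
  have := (hu (linking_elt 0 0 0 a')).1; rewrite linking_mulE !cmp.
  by case.
split=> [b'||| a'].
- by rewrite (hb b').1 (hb' b').1.
- by apply: ract_eq0 => a'; rewrite (ha' a').2.
- by apply: (@lact_eq0 _ _ _ E) => b'; rewrite -[b']sstarK (hb (sstar b')).2.
- by rewrite (ha a').1 (ha' a').1.
Qed.

End Linking.

(** * The action of [H] on the linking algebra *)

Section LinkingAction.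
Variables (R : realDomainType) (H : hopfStarType R) (B A : starAlgType R).
Variables (actB : star_action H B) (actA : star_action H A).
Variables (E : equivalence_bimodule B A) (act : H -> E -> E).
Hypotheses (act_mod : hopf_module act)
  (act_rip : forall g x y, actA g (rip x y) =
     tlift (fun g1 g2 => rip (act (σ g1) x) (act g2 y)) (comul g))
  (act_lip : forall g x y, actB g (lip x y) =
     tlift (fun g1 g2 => lip (act g1 x) (act (σ g2) y)) (comul g)).

(** The twist by [σ] on the adjoint corner is forced by the axiom [sact_star]. *)
Definition linking_act_fun (g : H) (l : linking E) : linking E :=
  let: (b, x, y, a) := l in
  linking_elt (actB g b) (act g x) (act (σ g) (y : E)) (actA g a).

Let act_bilin : bilin act. Proof. by case: act_mod. Qed.
Let bA : bilin actA. Proof. by case: (sact_module actA). Qed.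
Let bB : bilin actB. Proof. by case: (sact_module actB). Qed.

Let linking_act_funE g b x (y : conjmod E) a :
  linking_act_fun g (linking_elt b x y a) =
  linking_elt (actB g b) (act g x) (act (σ g) (y : E)) (actA g a).
Proof. by []. Qed.

Let linking_act_module : hopf_module linking_act_fun.
Proof.
split.
- have cmp := (bilinDl bA, bilinDl bB, bilinDl act_bilin, bilinDr bA, bilinDr bB,
    bilinDr act_bilin, bilinZl bA, bilinZl bB, bilinZl act_bilin, bilinZr bA,
    bilinZr bB, bilinZr act_bilin, star_antipodeD, star_antipodeZ).
  split=> [[[[b x] y] a] c g h|g c [[[b x] y] a] [[[b' x'] y'] a']];
    rewrite -![(_, _, _, _)]/(linking_elt _ _ _ _).
    rewrite [LHS]linking_act_funE [RHS]linking_eltP.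
    by congr (linking_elt _ _ _ _); rewrite !cmp.
  rewrite linking_eltP [LHS]linking_act_funE [RHS]linking_eltP.
  by congr (linking_elt _ _ _ _); rewrite !cmp.
- move=> [[[b x] y] a] /=; case: act_mod (sact_module actB) (sact_module actA).
  by move=> _ e1 _ [_ eB _] [_ eA _]; rewrite eB eA e1 /σ antipode1 hstar1 e1.
- move=> g h [[[b x] y] a] /=; case: act_mod (sact_module actB) (sact_module actA).
  by move=> _ _ e1 [_ _ eB] [_ _ eA]; rewrite eB eA e1 /σ antipodeM hstarM e1.
Qed.

Let lE := lact_bilin E.
Let rE := ract_bilin E.

Let sum_linking (I : Type) (s : seq I) (f : I -> B) (f1 f2 : I -> E) (f3 : I -> A) :
  \sum_(i <- s) linking_elt (f i) (f1 i) (f2 i) (f3 i) =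
  linking_elt (\sum_(i <- s) f i) (\sum_(i <- s) f1 i)
     (\sum_(i <- s) f2 i) (\sum_(i <- s) f3 i).
Proof.
elim: s => [|p s IH]; first by rewrite !big_nil.
by rewrite !big_cons IH.
Qed.

(** The diagonal entries combine the product rules of [actB] and [actA] with covariance of the inner
    products; the off-diagonal ones are the four compatibilities with [lact] and [ract]. *)
Let linking_actM g (l m : linking E) : linking_act_fun g (l ** m) =
  tlift (fun g1 g2 => linking_act_fun g1 l ** linking_act_fun g2 m) (comul g).
Proof.
case: l m => [[[b x] y] a] [[[b' x'] y'] a'].
have sact_antipode (C : starAlgType R) (actC : star_action H C) k c :
    sstar (actC k c) = actC (σ k) (sstar c) by rewrite sact_star.
rewrite -![(_, _, _, _)]/(linking_elt _ _ _ _) linking_mulE linking_act_funE.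
under eq_tlift => g1 g2 do rewrite !linking_act_funE linking_mulE.
rewrite /tlift sum_linking /=; congr (linking_elt _ _ _ _); rewrite big_split /=.
- by rewrite (bilinDr bB) sactM act_lip.
- rewrite (bilinDr act_bilin).
  by rewrite (act_lact act_mod act_rip act_lip) (act_ract act_mod act_rip).
- rewrite (bilinDr act_bilin).
  rewrite (act_antipode_lact act_mod act_lip) (act_antipode_ract act_mod act_rip act_lip).
  by congr (_ + _); apply: eq_bigr => p _; rewrite sact_antipode.
- by rewrite (bilinDr bA) sactM act_rip.
Qed.

Let linking_act_star g (l : linking E) :
  sstar (linking_act_fun g l) = linking_act_fun (hstar (antipode g)) (sstar l).
Proof.
case: l => [[[b x] y] a].
by congr (linking_elt _ _ _ _); rewrite ?sact_star // -/(σ _) star_antipodeK.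
Qed.

Let linking_act_unit (u : linking E) :
  is_unit_elt u -> forall g, linking_act_fun g u = counit g *: u.
Proof.
case: u => [[[b x] y] a] hu g.
have [hb x0 y0 ha] := linking_unit hu; rewrite -[X in X = _]/(linking_elt _ _ _ _).
rewrite -[X in _ = _ *: X]/(linking_elt _ _ _ _) -[RHS]addr0 linking_eltP !addr0.
by congr (linking_elt _ _ _ _); rewrite ?sact_unit ?x0 ?y0 ?(bilin0r act_bilin) ?scaler0.
Qed.

Definition linking_act : star_action H (linking E) :=
  Build_star_action linking_act_module linking_actM linking_act_star linking_act_unit.

Lemma linking_actE g b x (y : conjmod E) a :
  linking_act g (linking_elt b x y a) =
  linking_elt (actB g b) (act g x) (act (σ g) (y : E)) (actA g a).
Proof. by []. Qed.

End LinkingAction.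

(** * Crossed products *)

Section TensorMap.
Variables (K : comNzRingType) (H : lmodType K).

Definition tmap (U V : lmodType K) (f : U -> V) (t : tens U H) : tens V H :=
  tlift (fun u h => f u ⊗ h) t.

Section Linear.
Variables (U V : lmodType K) (f : {linear U -> V}).

Let tmap_balanced : balanced (fun u (h : H) => f u ⊗ h).
Proof.
split=> [v x y|u x y|c u v]; rewrite ?linearD ?pureDl ?pureDr //.
by rewrite linearZ pureZlr.
Qed.

Lemma tmap_pure u h : tmap f (u ⊗ h) = f u ⊗ h.
Proof. exact: tlift_pure tmap_balanced _ _. Qed.

Let tmap_linear : linear (tmap f).
Proof.
apply: tlift_linear; split=> [v c x y|u c x y].
  by rewrite linearP pureDl pureZl.
by rewrite pureDr pureZr.
Qed.

HB.instance Definition _ := GRing.isLinear.Build K (tens U H) (tens V H) _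
  (tmap f) tmap_linear.

End Linear.

(** Over a ring that is not a field, tensoring may destroy injectivity; a left inverse survives, and
    the corner inclusions of the linking algebra have one. *)
Lemma tmapK (U V : lmodType K) (f : {linear U -> V}) (g : {linear V -> U}) :
  cancel f g -> cancel (tmap f) (tmap g).
Proof.
move=> fK; apply: tens_ind => [|u h|s t es et]; first by rewrite !linear0.
  by rewrite !tmap_pure fK.
by rewrite !linearD /= es et.
Qed.

Lemma spanning_tens (V : lmodType K) (P : V -> Prop) (Q : tens V H -> Prop) :
  (forall v h, P v -> Q (v ⊗ h)) -> spanning P -> spanning Q.
Proof.
move=> PQ sP; apply: tens_ind => [|v h|t t' [s [hs ->]] [s' [hs' ->]]].
- by exists [::]; rewrite big_nil.
- have [s [hs ->]] := sP v; exists [seq (p.1, p.2 ⊗ h) | p <- s]; split.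
    by move=> _ /mapP[p ps ->]; apply/PQ/hs.
  have pure0 : (0 : V) ⊗ h = 0 by apply: (addrI (0 ⊗ h)); rewrite -pureDl !addr0.
  rewrite big_map (big_morph _ (pureDl h) pure0).
  by apply: eq_bigr => p _; rewrite pureZl.
- exists (s ++ s'); split; last by rewrite big_cat.
  by move=> p; rewrite mem_cat => /orP[/hs|/hs'].
Qed.

End TensorMap.

(** * Compression of matrices over the coefficient algebra *)

Section CrossedSandwich.
Variables (R : realDomainType) (H : hopfStarType R) (A : starAlgType R).
Variable act : star_action H A.
Implicit Types (a b : A) (g h : H).

Let bA : bilin act. Proof. by case: (sact_module act). Qed.

(** A first factor with [1] in [H] multiplies without a Sweedler sum, which carries spanning by
    products over to the tensor product with [H]. *)
Lemma crossed_mul1pure a b h :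
  ((a ⊗ 1 : crossed act) ** (b ⊗ h : crossed act)) = (a ** b) ⊗ h.
Proof.
have act1 c : act 1 c = c by case: (sact_module act).
rewrite [LHS]crossed_mul_pure comul1 tlift_pure ?act1 ?mul1r //.
split=> [v x y|u x y|c u v]; rewrite ?(bilinDl bA) ?smulDr ?pureDl ?mulrDl ?pureDr //.
by rewrite (bilinZl bA) smulZr pureZl -scalerAl pureZr.
Qed.

(* For unital [A] this is [(1 ⊗ g)^* (a ⊗ 1) (1 ⊗ h)]. *)
Definition crossed_sandwich g a h : crossed act :=
  tlift (fun g1 g2 => act g1 a ⊗ (g2 * h)) (comul (hstar g)).

Lemma crossed_sandwich_linear g h : linear (fun a => crossed_sandwich g a h).
Proof.
move=> c a b; rewrite /crossed_sandwich (tlift_morph (scalerDr c)) -tlift_addf.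
by apply: eq_tlift => g1 g2; rewrite (bilinDr bA) (bilinZr bA) pureDl pureZl.
Qed.

(** Once the star is expressed by the coproduct of [hstar g], coassociativity joins the actions on
    [sstar a] and on [b] into one action on their product. *)
Lemma crossed_star_mul a g b h :
  sstar (a ⊗ g : crossed act) ** (b ⊗ h : crossed act) =
  crossed_sandwich g (sstar a ** b) h.
Proof.
pose F g1 g2 g3 : tens A H := (act g1 (sstar a) ** act g2 b) ⊗ (g3 * h).
have bF : tribalanced F.
  split=> ? ? ? ? /=; rewrite /F ?(bilinDl bA, bilinZl bA, smulDl, smulDr, smulZl,
    smulZr, mulrDl, pureDl, pureDr, pureZl, pureZr) //.
  by rewrite -scalerAl pureZr.
have bs : balanced (fun g1 g2 => act g1 (sstar a) ⊗ g2).
  by split=> ? ? ? /=; rewrite ?(bilinDl bA, bilinZl bA, pureDl, pureDr, pureZl, pureZr).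
rewrite [X in X ** _]crossed_star_pure -(sweedler_star bs).
rewrite (tlift_morph (smulDl _)).
transitivity (tlift (fun g1 g2 => tlift (F g1) (comul g2)) (comul (hstar g))).
  by apply: eq_tlift => g1 g2; rewrite [LHS]crossed_mul_pure.
rewrite -(sweedlerA bF); apply: eq_tlift => g1 g2.
by rewrite sactM (tlift_morph (pureDl _)).
Qed.

(** This is [C^* M C] for the [N] by [n] matrix [C] whose row [p] has the single entry [1 ⊗ g p], in
    column [i p]; it is written out because [A] may lack a unit. *)
Let sandwich_mx N n (i : 'I_N -> 'I_n) (g : 'I_N -> H) (M : starmx A N) :
    starmx (crossed act) n :=
  \matrix_(k, l) \sum_(p | i p == k) \sum_(q | i q == l)
     crossed_sandwich (g p) (M p q) (g q).

Let sandwich_mx_linear N n (i : 'I_N -> 'I_n) (g : 'I_N -> H) : linear (sandwich_mx i g).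
Proof.
move=> c M M'; apply/matrixP=> k l; rewrite !mxE scaler_sumr -big_split.
apply: eq_bigr => p _; rewrite scaler_sumr -big_split; apply: eq_bigr => q _.
by rewrite !mxE; apply: crossed_sandwich_linear.
Qed.

(** [sstar M ** M] is the sum over the rows of [M] of adjoint row times row, and by
    [crossed_star_mul] compression preserves this shape. *)
Let sandwich_mx_sum N n (i : 'I_N -> 'I_n) (g : 'I_N -> H) (M : starmx A N) :
  exists X : 'I_N -> starmx (crossed act) n,
  sandwich_mx i g (sstar M ** M) = \sum_r sstar (X r) ** X r.
Proof.
pose z r l : crossed act := \sum_(q | i q == l) (M r q ⊗ g q : tens A H).
(* The compressed row is made a square matrix by zero rows. Its position does not affect the
   product, and [i r] supplies an index although [n] is not known to be positive. *)
pose X r : starmx (crossed act) n :=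
  \matrix_(k, l) if k == i r then z r l else 0.
exists X; apply/matrixP=> k l; rewrite summxE mxE.
transitivity (\sum_r \sum_(p | i p == k) \sum_(q | i q == l)
    crossed_sandwich (g p) (sstar (M r p) ** M r q) (g q)).
  rewrite [RHS]exchange_big; apply: eq_bigr => p _; rewrite [RHS]exchange_big.
  apply: eq_bigr => q _; rewrite mxE.
  have lin := crossed_sandwich_linear (g p) (g q).
  pose f : {linear A -> crossed act} := HB.pack (fun a => crossed_sandwich (g p) a (g q))
    (GRing.isLinear.Build _ _ _ _ _ lin).
  rewrite -[LHS]/(f _) linear_sum; by apply: eq_bigr => r _; rewrite mxE.
apply: eq_bigr => r _; rewrite mxE [RHS](bigD1 (i r)) //= [X in _ + X]big1
  ?addr0; last first.
  by move=> m /negbTE e; rewrite !mxE e smul0r.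
rewrite !mxE eqxx /z (big_morph _ (@sstarD _ _) (@sstar0 _ _)).
rewrite (big_morph _ (smulDl _) (smul0l _)); apply: eq_bigr => p _.
rewrite (big_morph _ (smulDr _) (smul0r _)); apply: eq_bigr => q _.
by rewrite -crossed_star_mul.
Qed.

(** By [sandwich_mx_sum] a positive functional stays positive when composed with the compression, so
    positivity of [M] can be applied to the composite. *)
Lemma crossed_sandwich_positive N n (i : 'I_N -> 'I_n) (g : 'I_N -> H) (M : starmx A N) :
  positive_elt M ->
  positive_elt (\matrix_(k, l) \sum_(p | i p == k) \sum_(q | i q == l)
    crossed_sandwich (g p) (M p q) (g q) : starmx (crossed act) n).
Proof.
move=> posM w posw; rewrite -[X in w X]/(sandwich_mx i g M).
pose T : {linear starmx A N -> starmx (crossed act) n} :=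
  HB.pack (sandwich_mx i g) (GRing.isLinear.Build _ _ _ _ _ (@sandwich_mx_linear N n i g)).
have wl : scalar (fun M => w (T M)) by move=> c M1 M2; rewrite !linearP.
pose w' : {scalar starmx A N} := HB.pack (fun M => w (T M))
  (GRing.isLinear.Build _ _ _ _ _ wl).
apply: (posM w') => M1; rewrite -[w' _]/(w (sandwich_mx i g _)).
have [X ->] := sandwich_mx_sum i g M1; rewrite linear_sum.
apply: big_ind => [|x y [x0 x1] [y0 y1]|r _]; last exact: posw.
  by split.
move: x y x0 x1 y0 y1 => [x x'] [y y'] /= x0 x1 y0 y1.
by split; rewrite /= ?x0 ?y0 ?addr0 ?addr_ge0.
Qed.

End CrossedSandwich.

(** * Maps into a crossed product induced by maps of coefficients *)

Section CrossedMap.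
Variables (R : realDomainType) (H : hopfStarType R) (L : starAlgType R).
Variable act : star_action H L.

(** This is [tmap] with the crossed product as codomain; [U] is only a module, so that off-diagonal
    corners are covered. *)
Definition crossed_map (U : lmodType (cpx R)) (f : U -> L) : tens U H -> crossed act :=
  tmap f.

HB.instance Definition _ (U : lmodType (cpx R)) (f : {linear U -> L}) :=
  GRing.isLinear.Build _ (tens U H) (crossed act) _ (crossed_map f)
    (linearP (tmap f : {linear tens U H -> tens L H})).

Lemma crossed_map_pure (U : lmodType (cpx R)) (f : {linear U -> L}) u h :
  crossed_map f (u ⊗ h) = f u ⊗ h.
Proof. exact: tmap_pure. Qed.

Let crossed_mapD (U : lmodType (cpx R)) (f : {linear U -> L}) :
  {morph crossed_map f : s t / s + t >-> s + t}.
Proof. exact: linearD. Qed.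

(** The composite of [p] and [k] plays the part of a projection onto a corner. The product of pure
    tensors is a Sweedler sum of terms whose coefficients it fixes, and additivity does the rest. *)
Lemma crossed_map_mul_closed (U V W : lmodType (cpx R)) (f : {linear U -> L})
    (f' : {linear V -> L}) (k : {linear W -> L}) (p : {linear L -> W}) :
  (forall u g v, k (p (f u ** act g (f' v))) = f u ** act g (f' v)) ->
  forall s t, crossed_map k (tmap p (crossed_map f s ** crossed_map f' t)) =
              crossed_map f s ** crossed_map f' t.
Proof.
move=> hk s t; pose q : {linear tens L H -> tens L H} := tmap k \o tmap p.
rewrite -[LHS]/(q _); elim/tens_ind: s => [|u g|s s' es es'].
- by rewrite linear0 smul0l linear0.
- elim/tens_ind: t => [|v h|t t' et et']; first by rewrite linear0 smul0r linear0.
    rewrite !crossed_map_pure [X in q X = X]crossed_mul_pure (tlift_morph (linearD q)).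
    by apply: eq_tlift => g1 g2; rewrite /q /= !tmap_pure hk.
  by rewrite linearD smulDr linearD et et'.
- by rewrite linearD smulDl linearD es es'.
Qed.

Lemma crossed_map_star_closed (U W : lmodType (cpx R)) (f : {linear U -> L})
    (k : {linear W -> L}) (p : {linear L -> W}) :
  (forall g u, k (p (act g (sstar (f u)))) = act g (sstar (f u))) ->
  forall s, crossed_map k (tmap p (sstar (crossed_map f s))) = sstar (crossed_map f s).
Proof.
move=> hk s; pose q : {linear tens L H -> tens L H} := tmap k \o tmap p.
rewrite -[LHS]/(q _); elim/tens_ind: s => [|u g|s s' es es'].
- by rewrite linear0 sstar0 linear0.
- rewrite !crossed_map_pure [X in q X = X]crossed_star_pure (tlift_morph (linearD q)).
  by apply: eq_tlift => g1 g2; rewrite /q /= !tmap_pure hk.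
- by rewrite linearD sstarD linearD es es'.
Qed.

Section Equivariant.
Variables (A : starAlgType R) (actA : star_action H A) (f : {linear A -> L}).
Hypotheses (f_mul : {morph f : a b / a ** b}) (f_star : {morph f : a / sstar a}).
Hypothesis f_act : forall g a, f (actA g a) = act g (f a).

Lemma crossed_mapM (s t : crossed actA) :
  crossed_map f (s ** t) = crossed_map f s ** crossed_map f t.
Proof.
elim/tens_ind: s => [|a g|s s' es es'].
- by rewrite smul0l linear0 smul0l.
- elim/tens_ind: t => [|b h|t t' et et']; first by rewrite smul0r linear0 smul0r.
    rewrite [X in crossed_map f X]crossed_mul_pure !crossed_map_pure.
    rewrite [RHS]crossed_mul_pure (tlift_morph (crossed_mapD f)).
    by apply: eq_tlift => g1 g2; rewrite crossed_map_pure f_mul f_act.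
  by rewrite smulDr crossed_mapD et et' crossed_mapD smulDr.
- by rewrite smulDl crossed_mapD es es' crossed_mapD smulDl.
Qed.

Lemma crossed_map_star (s : crossed actA) :
  crossed_map f (sstar s) = sstar (crossed_map f s).
Proof.
elim/tens_ind: s => [|a g|s s' es es'].
- by rewrite sstar0 linear0 sstar0.
- rewrite [X in crossed_map f X]crossed_star_pure !crossed_map_pure.
  rewrite [RHS]crossed_star_pure (tlift_morph (crossed_mapD f)).
  by apply: eq_tlift => g1 g2; rewrite crossed_map_pure f_act f_star.
- by rewrite sstarD crossed_mapD es es' crossed_mapD sstarD.
Qed.

Lemma crossed_map_sandwich g a h :
  crossed_map f (crossed_sandwich actA g a h) = crossed_sandwich act g (f a) h.
Proof.
rewrite (tlift_morph (crossed_mapD f)).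
by apply: eq_tlift => g1 g2; rewrite crossed_map_pure f_act.
Qed.

(** [U] is an off-diagonal corner and [cip s t] is the adjoint of [s] times [t], computed in the
    crossed product by [L]. Taking [U] to be [E] or its conjugate covers both inner products. *)
Variables (U : lmodType (cpx R)) (k : {linear U -> L}) (ip : U -> U -> A).
Hypothesis ipE : forall x y, f (ip x y) = sstar (k x) ** k y.
Hypothesis f_inj : injective (crossed_map f).
Variable cip : tens U H -> tens U H -> crossed actA.
Hypothesis cipE : forall s t,
  crossed_map f (cip s t) = sstar (crossed_map k s) ** crossed_map k t.

Let cip_pure x g y h : cip (x ⊗ g) (y ⊗ h) = crossed_sandwich actA g (ip x y) h.
Proof.
by apply: f_inj; rewrite cipE !crossed_map_pure crossed_star_mul crossed_map_sandwich ipE.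
Qed.

(** [cip (x ⊗ 1) (y ⊗ h)] is the tensor of [ip x y] and [h], and such tensors span. *)
Lemma crossed_ip_full : full_ip ip -> full_ip cip.
Proof.
apply: spanning_tens => _ h [x [y ->]]; exists (x ⊗ 1), (y ⊗ h).
have [bA act1 _] := sact_module actA.
rewrite cip_pure /crossed_sandwich hstar1 comul1 tlift_pure ?act1 ?mul1r //.
split=> [v a b|u a b|c u v]; rewrite ?(bilinDl bA) ?pureDl ?mulrDl ?pureDr //.
by rewrite (bilinZl bA) pureZl -scalerAl pureZr.
Qed.

(** With all [z j] expanded into pure tensors, the matrix of [cip] is the compression of the matrix
    of [ip] on their first factors. *)
Lemma crossed_ip_completely_positive :
  completely_positive ip -> completely_positive cip.
Proof.
move=> cp n z.
(* The pure tensors of all [z j], each tagged with its [j]; the tag is the column index in the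
   compression. *)
pose s := flatten [seq [seq (j, q) | q <- trepr (z j)] | j <- enum 'I_n].
pose e (p : 'I_(size s)) := tnth (in_tuple s) p.
have zE j : z j = \sum_(p | (e p).1 == j) (e p).2.1 ⊗ (e p).2.2.
  rewrite -(big_tnth _ _ _ (fun q => q.1 == j) (fun q => q.2.1 ⊗ q.2.2)).
  rewrite big_flatten big_map big_enum_cond (bigD1 j) //= [X in _ + X]big1 ?addr0.
    rewrite big_map -[LHS]treprK tclass_sum; apply: eq_bigl => q.
    by rewrite /= eqxx.
  by move=> i /negbTE ij; rewrite big_map big1 //= => q; rewrite ij.
have -> : \matrix_(j, l) cip (z j) (z l) = \matrix_(j, l)
    \sum_(p | (e p).1 == j) \sum_(q | (e q).1 == l) crossed_sandwich actA (e p).2.2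
      ((\matrix_(p, q) ip (e p).2.1 (e q).2.1 : starmx A (size s)) p q) (e q).2.2.
  apply/matrixP=> j l; rewrite !mxE; apply: f_inj; rewrite cipE !zE !linear_sum.
  rewrite (big_morph _ (@sstarD _ _) (@sstar0 _ _)).
  rewrite (big_morph _ (smulDl _) (smul0l _)); apply: eq_bigr => p _.
  rewrite linear_sum (big_morph _ (smulDr _) (smul0r _)); apply: eq_bigr => q _.
  by rewrite -cipE mxE cip_pure.
exact/crossed_sandwich_positive/cp.
Qed.

End Equivariant.
End CrossedMap.

(** * Corner inclusions and entries of the linking algebra *)

Section Corners.
Variables (R : realDomainType) (B A : starAlgType R) (E : equivalence_bimodule B A).

Definition corner11 (b : B) : linking E := linking_elt b 0 0 0.
Definition corner12 (x : E) : linking E := linking_elt 0 x 0 0.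
Definition corner21 (y : conjmod E) : linking E := linking_elt 0 0 y 0.
Definition corner22 (a : A) : linking E := linking_elt 0 0 0 a.
Definition entry11 (l : linking E) : B := l.1.1.1.
Definition entry12 (l : linking E) : E := l.1.1.2.
Definition entry21 (l : linking E) : conjmod E := l.1.2.
Definition entry22 (l : linking E) : A := l.2.

Let corner11_linear : linear corner11.
Proof. by move=> c b b'; rewrite linking_eltP !scaler0 !addr0. Qed.
Let corner12_linear : linear corner12.
Proof. by move=> c x x'; rewrite linking_eltP !scaler0 !addr0. Qed.
Let corner21_linear : linear corner21.
Proof. by move=> c y y'; rewrite linking_eltP !scaler0 !addr0. Qed.
Let corner22_linear : linear corner22.
Proof. by move=> c a a'; rewrite linking_eltP !scaler0 !addr0. Qed.
Let entry11_linear : linear entry11. Proof. by []. Qed.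
Let entry12_linear : linear entry12. Proof. by []. Qed.
Let entry21_linear : linear entry21. Proof. by []. Qed.
Let entry22_linear : linear entry22. Proof. by []. Qed.

HB.instance Definition _ := GRing.isLinear.Build _ _ _ _ corner11 corner11_linear.
HB.instance Definition _ := GRing.isLinear.Build _ _ _ _ corner12 corner12_linear.
HB.instance Definition _ := GRing.isLinear.Build _ _ _ _ corner21 corner21_linear.
HB.instance Definition _ := GRing.isLinear.Build _ _ _ _ corner22 corner22_linear.
HB.instance Definition _ := GRing.isLinear.Build _ _ _ _ entry11 entry11_linear.
HB.instance Definition _ := GRing.isLinear.Build _ _ _ _ entry12 entry12_linear.
HB.instance Definition _ := GRing.isLinear.Build _ _ _ _ entry21 entry21_linear.
HB.instance Definition _ := GRing.isLinear.Build _ _ _ _ entry22 entry22_linear.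

End Corners.

(** * The equivalence bimodule of the crossed products *)

Section CrossedBimodule.
Variables (R : realDomainType) (H : hopfStarType R) (B A : starAlgType R).
Variables (actB : star_action H B) (actA : star_action H A).
Variables (E : equivalence_bimodule B A) (act : H -> E -> E).
Hypotheses (act_mod : hopf_module act)
  (act_rip : forall g x y, actA g (rip x y) =
     tlift (fun g1 g2 => rip (act (σ g1) x) (act g2 y)) (comul g))
  (act_lip : forall g x y, actB g (lip x y) =
     tlift (fun g1 g2 => lip (act g1 x) (act (σ g2) y)) (comul g)).
Hypotheses (ndA : nondegenerate_alg (crossed actA)).
Hypotheses (ndB : nondegenerate_alg (crossed actB)).

Let actL := linking_act act_mod act_rip act_lip.

Let iB : {linear B -> linking E} := @corner11 _ _ _ E.
Let iE : {linear E -> linking E} := @corner12 _ _ _ E.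
Let iE' : {linear conjmod E -> linking E} := @corner21 _ _ _ E.
Let iA : {linear A -> linking E} := @corner22 _ _ _ E.
Let pB : {linear linking E -> B} := @entry11 _ _ _ E.
Let pE : {linear linking E -> E} := @entry12 _ _ _ E.
Let pE' : {linear linking E -> conjmod E} := @entry21 _ _ _ E.
Let pA : {linear linking E -> A} := @entry22 _ _ _ E.

Let act_bilin : bilin act. Proof. by case: act_mod. Qed.
Let bA : bilin actA. Proof. by case: (sact_module actA). Qed.
Let bB : bilin actB. Proof. by case: (sact_module actB). Qed.
Let lE := lact_bilin E.
Let rE := ract_bilin E.

Let zeros := (bilin0l lE, bilin0r lE, bilin0l rE, bilin0r rE, bilin0r act_bilin,
  bilin0r bA, bilin0r bB, lip0l, lip0r, rip0l, rip0r, smul0l, smul0r, sstar0,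
  addr0, add0r).

Let iB_mul : {morph iB : b b' / b ** b'}.
Proof. by move=> b b'; rewrite /iB /= [RHS]linking_mulE !zeros. Qed.

Let iA_mul : {morph iA : a a' / a ** a'}.
Proof. by move=> a a'; rewrite /iA /= [RHS]linking_mulE !zeros. Qed.

Let iB_star : {morph iB : b / sstar b}.
Proof. by move=> b; rewrite /iB /= [RHS]linking_starE !zeros. Qed.

Let iA_star : {morph iA : a / sstar a}.
Proof. by move=> a; rewrite /iA /= [RHS]linking_starE !zeros. Qed.

Let iB_act g b : iB (actB g b) = actL g (iB b).
Proof. by rewrite [RHS]linking_actE !zeros. Qed.

Let iA_act g a : iA (actA g a) = actL g (iA a).
Proof. by rewrite [RHS]linking_actE !zeros. Qed.

Let iE_act g x : actL g (iE x) = iE (act g x).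
Proof. by rewrite [LHS]linking_actE !zeros. Qed.

Let iE'_act g (y : conjmod E) : actL g (iE' y) = iE' (act (σ g) (y : E)).
Proof. by rewrite [LHS]linking_actE !zeros. Qed.

Let iE_star x : sstar (iE x) = iE' x.
Proof. by rewrite [LHS]linking_starE !zeros. Qed.

Let iE'_star y : sstar (iE' y) = iE y.
Proof. by rewrite [LHS]linking_starE !zeros. Qed.

Let iB_iE b x : iB b ** iE x = iE (lact b x).
Proof. by rewrite [LHS]linking_mulE !zeros. Qed.

Let iE_iA x a : iE x ** iA a = iE (ract x a).
Proof. by rewrite [LHS]linking_mulE !zeros. Qed.

Let iE_iE' x (y : conjmod E) : iE x ** iE' y = iB (lip x (y : E)).
Proof. by rewrite [LHS]linking_mulE !zeros. Qed.

Let iE'_iE (y : conjmod E) x : iE' y ** iE x = iA (rip (y : E) x).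
Proof. by rewrite [LHS]linking_mulE !zeros. Qed.

Let jB : {linear crossed actB -> crossed actL} :=
  HB.pack (crossed_map actL iB) (GRing.isLinear.Build _ _ _ _ _
    (linearP (crossed_map actL iB))).
Let jA : {linear crossed actA -> crossed actL} :=
  HB.pack (crossed_map actL iA) (GRing.isLinear.Build _ _ _ _ _
    (linearP (crossed_map actL iA))).
Let jE : {linear tens E H -> crossed actL} := crossed_map actL iE.
Let jE' : {linear tens (conjmod E) H -> crossed actL} := crossed_map actL iE'.

Let jB_inj : injective jB.
Proof. by apply: can_inj (tmapK (f := iB) (g := pB) _) => u. Qed.

Let jA_inj : injective jA.
Proof. by apply: can_inj (tmapK (f := iA) (g := pA) _) => u. Qed.

Let jE_inj : injective jE.
Proof. by apply: can_inj (tmapK (f := iE) (g := pE) _) => u. Qed.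

Let jE'_inj : injective jE'.
Proof. by apply: can_inj (tmapK (f := iE') (g := pE') _) => u. Qed.


(** The operations are products in the crossed product by the linking algebra, projected to a
    corner. By [lactE] and its analogues the products already lie in that corner, so the projection
    loses nothing. *)
Definition crossed_lact (b : crossed actB) (z : tens E H) : tens E H :=
  tmap pE (jB b ** jE z).
Definition crossed_ract (z : tens E H) (a : crossed actA) : tens E H :=
  tmap pE (jE z ** jA a).
(* [crossed_flip z] is [z^*], an element of the opposite corner. *)
Definition crossed_flip (z : tens E H) : tens (conjmod E) H :=
  tmap pE' (sstar (jE z)).
(** On the opposite corner the left inner product takes the form of an adjoint times an element, to
    which [crossed_ip_full] and [crossed_ip_completely_positive] apply. *)
Definition crossed_lip' (z w : tens (conjmod E) H) : crossed actB :=
  tmap pB (sstar (jE' z) ** jE' w).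
Definition crossed_lip (z w : tens E H) : crossed actB :=
  crossed_lip' (crossed_flip z) (crossed_flip w).
Definition crossed_rip (z w : tens E H) : crossed actA :=
  tmap pA (sstar (jE z) ** jE w).

Let lactE b z : jE (crossed_lact b z) = jB b ** jE z.
Proof.
by apply: crossed_map_mul_closed => c g x; rewrite iE_act iB_iE.
Qed.

Let ractE z a : jE (crossed_ract z a) = jE z ** jA a.
Proof.
by apply: crossed_map_mul_closed => x g c; rewrite -iA_act iE_iA.
Qed.

Let flipE z : jE' (crossed_flip z) = sstar (jE z).
Proof.
by apply: crossed_map_star_closed => g x; rewrite iE_star iE'_act.
Qed.

Let flip_onto (w : tens (conjmod E) H) : exists z, w = crossed_flip z.
Proof.
(* The adjoint of [jE' w] lies in the corner of [E], so [w] is the flip of its projection. *)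
have e : jE (tmap pE (sstar (jE' w))) = sstar (jE' w).
  by apply: crossed_map_star_closed => g x; rewrite iE'_star iE_act.
by exists (tmap pE (sstar (jE' w))); apply: jE'_inj; rewrite flipE e sstarK.
Qed.

Let ripE z w : jA (crossed_rip z w) = sstar (jE z) ** jE w.
Proof.
rewrite /crossed_rip -flipE; apply: crossed_map_mul_closed => y g x.
by rewrite iE_act iE'_iE.
Qed.

Let lip'E z w : jB (crossed_lip' z w) = sstar (jE' z) ** jE' w.
Proof.
rewrite /crossed_lip'; have [z' ->] := flip_onto z; rewrite flipE sstarK.
by apply: crossed_map_mul_closed => x g y; rewrite iE'_act iE_iE'.
Qed.

Let lipE z w : jB (crossed_lip z w) = jE z ** sstar (jE w).
Proof. by rewrite lip'E !flipE sstarK. Qed.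

Let lact_sp : spanning (fun z => exists b x, z = crossed_lact b x).
Proof.
apply: spanning_tens (@lact_span _ _ _ E) => _ h [b [x ->]].
exists (b ⊗ 1), (x ⊗ h); apply: jE_inj; rewrite lactE.
by rewrite -[jB _]/(crossed_map _ _ _) /jE /= !crossed_map_pure crossed_mul1pure iB_iE.
Qed.

Let ract_sp : spanning (fun z => exists x a, z = crossed_ract x a).
Proof.
apply: spanning_tens (@ract_span _ _ _ E) => _ h [x [a ->]].
exists (x ⊗ 1), (a ⊗ h); apply: jE_inj; rewrite ractE.
by rewrite -[jA _]/(crossed_map _ _ _) /jE /= !crossed_map_pure crossed_mul1pure iE_iA.
Qed.

Let rip_sp : full_ip crossed_rip.
Proof.
apply: (crossed_ip_full iA_act _ jA_inj ripE (@rip_full _ _ _ E)) => x y.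
by rewrite iE_star iE'_iE.
Qed.

Let lip'_sp : full_ip crossed_lip'.
Proof.
apply: (crossed_ip_full (ip := @lip _ _ _ E : conjmod E -> conjmod E -> B)
  iB_act _ jB_inj lip'E (@lip_full _ _ _ E)) => x y.
by rewrite iE'_star iE_iE'.
Qed.

Let lip_sp : full_ip crossed_lip.
Proof.
move=> b; have [s [hs e]] := lip'_sp b; exists s; split=> // p /hs[z [w ->]].
by have [[z' ->] [w' ->]] := (flip_onto z, flip_onto w); exists z', w'.
Qed.

(** Strength is stated as an implication so that a single construction serves both kinds of
    equivalence. *)
Lemma crossed_bimodule : exists Q : equivalence_bimodule (crossed actB) (crossed actA),
  strong_bimodule E -> strong_bimodule Q.
Proof.
have [||||Q [q [q_onto lipq ripq]]] := corner_bimodule jB_inj jA_inj jE_inj _ _ _ _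
  lactE ractE lipE ripE lact_sp ract_sp lip_sp rip_sp ndB ndA.
- exact: crossed_mapM iB_mul iB_act.
- exact: crossed_mapM iA_mul iA_act.
- exact: crossed_map_star iB_star iB_act.
- exact: crossed_map_star iA_star iA_act.
(* Finite families in the quotient come from families of tensors, and [q] preserves their Gram
   matrices. *)
have lift n (z : 'I_n -> Q) : exists w : 'I_n -> tens E H, z = q \o w.
  by have [w hw] := choice (fun i => q_onto (z i)); exists w; apply/funext.
exists Q => -[cpl cpr]; split=> n z; have [w ->] := lift n z.
  have -> : \matrix_(i, j) lip ((q \o w) i) ((q \o w) j) =
      \matrix_(i, j) crossed_lip' (crossed_flip (w i)) (crossed_flip (w j)).
    by apply/matrixP=> i j; rewrite !mxE lipq.
  apply: (crossed_ip_completely_positive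
    (ip := @lip _ _ _ E : conjmod E -> conjmod E -> B) iB_act _ jB_inj lip'E cpl) => x y.
  by rewrite iE'_star iE_iE'.
have -> : \matrix_(i, j) rip ((q \o w) i) ((q \o w) j) =
    \matrix_(i, j) crossed_rip (w i) (w j).
  by apply/matrixP=> i j; rewrite !mxE ripq.
apply: (crossed_ip_completely_positive iA_act _ jA_inj ripE cpr) => x y.
by rewrite iE_star iE'_iE.
Qed.

End CrossedBimodule.

Theorem corollary6p18 (R : realDomainType) (H : hopfStarType R)
    (A B : starAlgType R) (actA : star_action H A) (actB : star_action H B)
    (idemA : idempotent_alg A) (nondegA : nondegenerate_alg A)
    (idemB : idempotent_alg B) (nondegB : nondegenerate_alg B)
    (nondegAH : nondegenerate_alg (crossed actA))
    (nondegBH : nondegenerate_alg (crossed actB)) :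
  (covariantly_strongly_Morita_equivalent actA actB ->
     strongly_Morita_equivalent (crossed actA) (crossed actB)) /\
  (covariantly_star_Morita_equivalent actA actB ->
     star_Morita_equivalent (crossed actA) (crossed actB)).
Proof.
split=> [[E [sE [act [h1 h2 h3]]]]|[E [act [h1 h2 h3]]]];
  have [Q hQ] := crossed_bimodule h1 h2 h3 nondegAH nondegBH.
  by exists Q; apply: hQ.
by constructor.
Qed.
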